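(* Let $\mathfrak g=sl_{r+1}$ with first fundamental weight $\omega_1$ and let $n\ge0$ be an integer. Then the local Weyl module $W_{\mathbb C}(\{0\}_{n\omega_1})$ satisfies $$\dim W_{\mathbb C}(\{0\}_{n\omega_1})=(r+1)^n,$$ and for all non-negative integers $i_0,\dots,i_r$ with $i_0+\dots+i_r=n$ $$\dim W_{\mathbb C}(\{0\}_{n\omega_1})^{(i_0-i_1,\,i_1-i_2,\,\dots,\,i_{r-1}-i_r)}=\frac{n!}{i_0!\,i_1!\cdots i_r!}.$$
   Context: All vector spaces and algebras are over $\mathbb C$. Let $A=\mathbb C[x]$ be the algebra of functions on $\mathbb C$, and let $\mathfrak g\otimes A$ have the bracket $[x\otimes P,y\otimes Q]=[x,y]\otimes PQ$. Let $\mathfrak h$ be the Cartan subalgebra of $\mathfrak g=sl_{r+1}$ ($r\ge 1$), $\mathfrak n_+$ the positive nilpotent subalgebra, $h_1,\dots,h_r$ the simple coroots. A $\mathfrak g$-module $V$ is integrable if $V=\bigoplus_{\mu\in D}V^\mu$ for a finite subset $D$ of the weight lattice, where each $h\in\mathfrak h$ acts on $V^\mu$ by $\mu(h)$. The local Weyl module $W_{\mathbb C}(\{0\}_{n\omega_1})$ is the maximal $\mathfrak g\otimes A$-module that is integrable over $\mathfrak g\otimes1\cong\mathfrak g$ and generated by a vector $v$ with, for all $P\in A$, $(\mathfrak n_+\otimes P)v=0$, $(h_1\otimes P)v=nP(0)v$, $(h_i\otimes P)v=0$ for $i>1$. ''Maximal'' means that any other such module is a quotient of it (generator mapping to generator).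 The superscript $(s_1,\dots,s_r)$ denotes the weight subspace on which $h_j\otimes1$ acts by the scalar $s_j$ for $j=1,\dots,r$. *)

(* Defs.v *)
From HB Require Import structures.
From mathcomp Require Import all_boot all_order all_algebra.
From mathcomp Require Import reals complex.

Set Implicit Arguments.
Unset Strict Implicit.
Unset Printing Implicit Defensive.

Import Order.TTheory GRing.Theory Num.Theory.
Local Open Scope ring_scope.
Local Open Scope complex_scope.

(* The complex numbers are R[i] for R : realType; sl_{r+1} has rank r, its
   matrices are indexed by 'I_r.+1 and its simple coroots h_1, ..., h_r by
   0, ..., r.-1 : 'I_r. *)

Definition traceless (R : realType) (r : nat) : {pred 'M[R[i]]_r.+1} :=
  fun M => \tr M == 0.

Lemma traceless_submod_closed (R : realType) (r : nat) :
  submod_closed (@traceless R r).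
Proof.
split=> [|a x y]; rewrite !unfold_in /traceless ?mxtrace0 //.
by move=> /eqP hx /eqP hy; rewrite mxtraceD mxtraceZ hx hy mulr0 addr0.
Qed.

HB.instance Definition _ (R : realType) (r : nat) :=
  GRing.isSubmodClosed.Build R[i] 'M[R[i]]_r.+1 (@traceless R r)
    (@traceless_submod_closed R r).

Record sl (R : realType) (r : nat) : Type :=
  Sl { sl_mx :> 'M[R[i]]_r.+1; _ : sl_mx \in @traceless R r }.

HB.instance Definition _ (R : realType) (r : nat) :=
  [isSub for @sl_mx R r].
HB.instance Definition _ (R : realType) (r : nat) :=
  [Choice of sl R r by <:].
HB.instance Definition _ (R : realType) (r : nat) :=
  [SubChoice_isSubLmodule of sl R r by <:].

Fact bracket_subproof (R : realType) (r : nat) (x y : sl R r) :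
  x *m y - y *m x \in @traceless R r.
Proof. by rewrite unfold_in /traceless raddfB /= mxtrace_mulC subrr. Qed.

Definition bracket (R : realType) (r : nat) (x y : sl R r) : sl R r :=
  Sl (bracket_subproof x y).

Definition cartan (R : realType) (r : nat) (x : sl R r) : Prop :=
  is_diag_mx x.

Definition npos (R : realType) (r : nat) (x : sl R r) : Prop :=
  forall i j : 'I_r.+1, (j <= i)%N -> x i j = 0.

Fact coroot_subproof (R : realType) (r : nat) (i : 'I_r) :
  delta_mx (widen_ord (leqnSn r) i) (widen_ord (leqnSn r) i)
    - delta_mx (lift ord0 i) (lift ord0 i) \in @traceless R r.
Proof.
have tr_delta k : \tr (delta_mx k k : 'M[R[i]]_r.+1) = 1.
  rewrite /mxtrace (bigD1 k) //= mxE !eqxx big1 ?addr0 // => j /negPf jk.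
  by rewrite mxE jk.
by rewrite unfold_in /traceless raddfB /= !tr_delta subrr.
Qed.

(* lift ord0 i is the successor of i in 'I_r.+1. *)
Definition coroot (R : realType) (r : nat) (i : 'I_r) : sl R r :=
  Sl (coroot_subproof R i).

Definition fund_weight (R : realType) (r : nat) (i : 'I_r) (h : sl R r) :
    R[i] :=
  \sum_(j < r.+1 | (j <= i)%N) h j j.

Lemma fund_weight_coroot (R : realType) (r : nat) (i j : 'I_r) :
  fund_weight i (coroot R j) = (i == j)%:R.
Proof.
have sum_delta (k : 'I_r.+1) :
    \sum_(l < r.+1 | (l <= i)%N) (delta_mx k k : 'M[R[i]]_r.+1) l l
    = (k <= i)%N%:R.
  rewrite big_mkcond (bigD1 k) //= !mxE !eqxx big1 ?addr0 => [|l /negPf lk].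
    by case: ifP.
  by rewrite mxE lk; case: ifP.
rewrite /fund_weight /=; under eq_bigr do rewrite !mxE.
rewrite sumrB; have := sum_delta (widen_ord (leqnSn r) j).
have := sum_delta (lift ord0 j); under eq_bigr do rewrite mxE.
move=> ->; under eq_bigr do rewrite mxE.
move=> ->; rewrite lift0 /= -val_eqE /=.
by case: ltngtP; rewrite ?subrr ?subr0.
Qed.

(* An element of the weight lattice is encoded by its integer coordinates in
   the basis of fundamental weights. *)
Definition weight_eval (R : realType) (r : nat) (mu : {ffun 'I_r -> int})
    (h : sl R r) : R[i] :=
  \sum_(i < r) (mu i)%:~R * fund_weight i h.

(* A linear map out of a tensor product is a bilinear map, so a module over
   sl_{r+1} (x) C[x] is given by the operators cm_act x P of the pure tensors
   x (x) P. *)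
Record current_module (R : realType) (r : nat) : Type := CurrentModule {
  cm_space :> lmodType R[i];
  cm_act : sl R r -> {poly R[i]} -> cm_space -> cm_space;
  cm_linear_sl : forall P v, linear (fun x => cm_act x P v);
  cm_linear_poly : forall x v, linear (fun P => cm_act x P v);
  cm_linear : forall x P, linear (cm_act x P);
  cm_bracket : forall x y P Q v,
    cm_act (bracket x y) (P * Q) v =
    cm_act x P (cm_act y Q v) - cm_act y Q (cm_act x P v)
}.

Definition submodule (R : realType) (r : nat) (V : current_module R r)
    (U : V -> Prop) : Prop :=
  [/\ U 0,
      forall (a : R[i]) (u w : V), U u -> U w -> U (a *: u + w) &
      forall (x : sl R r) (P : {poly R[i]}) (u : V), U u -> U (cm_act x P u)].

Definition generated_by (R : realType) (r : nat) (V : current_module R r)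
    (v : V) : Prop :=
  forall U : V -> Prop, submodule U -> U v -> forall w, U w.

Definition weight_space (R : realType) (r : nat) (V : current_module R r)
    (mu : {ffun 'I_r -> int}) (v : V) : Prop :=
  forall h : sl R r, cartan h -> cm_act h 1 v = weight_eval mu h *: v.

(* V is regarded as a module over sl_{r+1} (x) 1.
   D enumerates the finite set of weights without repetition; the unique
   decomposition expresses that the sum of the weight spaces is direct. *)
Definition integrable_module (R : realType) (r : nat) (V : current_module R r) :
    Prop :=
  exists (k : nat) (D : 'I_k -> {ffun 'I_r -> int}), injective D /\
    forall v : V, exists! u : {ffun 'I_k -> V},
      (forall i, weight_space (D i) (u i)) /\ v = \sum_(i < k) u i.

Definition weyl_generator (R : realType) (r n : nat) (V : current_module R r)
    (v : V) : Prop :=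
  [/\ forall (x : sl R r) (P : {poly R[i]}), npos x -> cm_act x P v = 0,
      forall (i : 'I_r) (P : {poly R[i]}), i = 0%N :> nat ->
        cm_act (coroot R i) P v = (n%:R * P.[0]) *: v &
      forall (i : 'I_r) (P : {poly R[i]}), (0 < i)%N ->
        cm_act (coroot R i) P v = 0].

Definition weyl_candidate (R : realType) (r n : nat) (V : current_module R r)
    (v : V) : Prop :=
  [/\ integrable_module V, generated_by v & weyl_generator n v].

Definition pointed_quotient (R : realType) (r : nat)
    (V V' : current_module R r) (v : V) (v' : V') : Prop :=
  exists f : {linear V -> V'},
    [/\ forall (x : sl R r) (P : {poly R[i]}) (w : V),
          f (cm_act x P w) = cm_act x P (f w),
        forall w' : V', exists w : V, f w = w' &
        f v = v'].

Definition local_weyl_module (R : realType) (r n : nat)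
    (W : current_module R r) (v : W) : Prop :=
  weyl_candidate n v /\
  forall (V : current_module R r) (v' : V),
    weyl_candidate n v' -> pointed_quotient v v'.

(* The common eigenspace of the coroots with eigenvalues s. *)
Definition coroot_weight_space (R : realType) (r : nat)
    (V : current_module R r) (s : 'I_r -> int) (v : V) : Prop :=
  forall j : 'I_r, cm_act (coroot R j) 1 v = (s j)%:~R *: v.

Definition has_dim (R : realType) (V : lmodType R[i]) (U : V -> Prop)
    (d : nat) : Prop :=
  exists e : 'I_d -> V, (forall i, U (e i)) /\
    forall u : V, U u ->
      exists! a : 'rV[R[i]]_d, u = \sum_(i < d) a 0 i *: e i.

(* Main.v *)
Require Import Defs.
From HB Require Import structures.
From mathcomp Require Import all_boot all_order all_algebra.
From mathcomp Require Import reals complex.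
From mathcomp Require Import perm boolp functions mpoly.
From mathcomp Require Import ring zify.

Set Implicit Arguments.
Unset Strict Implicit.
Unset Printing Implicit Defensive.

Import Order.TTheory GRing.Theory Num.Theory.
Local Open Scope ring_scope.
Local Open Scope complex_scope.

(**
Write V for C^(r+1) with basis indexed by 0, ..., r, and E_ab (x) t^d for the
action of the matrix unit E_ab with coefficient t^d; it is defined for all a
and b by projecting gl_(r+1) to sl_(r+1).  Put f_j = E_j0 for j > 0, and let
[v] be the generator of the local Weyl module [W].  The multinomial coefficient
n!/(i_0! ... i_r!) is an upper bound for the dimension of the weight space of
type (i_0, ..., i_r), and (r+1)^n is a lower bound for the dimension of [W].
Since the sum of all multinomial coefficients is (r+1)^n, both are equalities.

Upper bound.  By sl_2 theory in an integrable module, E_ab (x) t^d kills [v]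
unless a = b or b = 0, so that [W] is spanned by the words in the commuting
operators f_j (x) t^d applied to [v] ([weyl_hw], [generated_words]).  The words
with i_j factors f_j, for j > 0, are the images of the monomials under a linear
map [Phi] from a polynomial ring S, one variable x_l being attached to each
factor; multiplication by the power sum of the x_l of one block j is the action
of E_jj (x) t^a ([Phi_psum]).  From f_j^(n+1) v = 0, and the action of
E_0j (x) t, the map [Phi] vanishes on the multiples of the complete symmetric
function h_s of all m variables when m + s > n ([series_eq0],
[Phi_hsym_eq0]).  Put F_j = \prod_(l in block j) (X - x_l), of degree i_j.  The
vanishing gives a monic polynomial of degree i_0 whose product with F_1, ...,
F_r has coefficients in the subring K of the elements of S acting on the image
of [Phi] by scalars ([Phi_scalar_product]).

It remains to bound an extension of a ring by the coefficients of the factors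
of a polynomial.  If F Q = D with D of degree n over K and F monic of degree k,
then K[coefficients of F] is spanned over K by 'C(n, k) elements
([adjoin_subset_minors]): these are the maximal minors of the matrix whose rows
are the remainders of 1, X, ..., X^(n-1) modulo F.  Indeed, if C is the
companion matrix of F and U_g is the submatrix of the rows selected by g, then
\det(U_g (X - C)) = \det(U_g) F, and the left-hand side expands into minors
with coefficients in K[X], since multiplication by C on the rows is given by
the companion matrix of D.  Iterating over F_1, ..., F_r gives a product of
binomial coefficients, which is the multinomial coefficient
([adjoin_coefs_span], [type_span]).  As the power sums of a block belong to
K[coefficients of F_j] by Newton's identities ([power_sum_in]), the image of
this ring under [Phi] contains all words of the given type ([wordm_span]).

Lower bound.  The tensor power of n copies of V, evaluated at n distinct
points, is cyclic of dimension (r+1)^n ([tensor_generated]).  Its associated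
graded module for the filtration by the degree in t is an admissible quotient
of [W]: taking the graded module turns the eigenvalues of the Cartan subalgebra
with coefficients in t C[t] into zero.  It is built on coordinates, by choosing
a basis of words of minimal total degree ([adapted_basis]) and keeping from the
matrix of x (x) t^d the entries which raise the degree by exactly d
([graded_module], [weyl_candidate_exists]).
*)

(** * Subrings and their extensions by the coefficients of a factor *)

Section Subrings.
Variable S : comNzRingType.
Implicit Types (K A : S -> Prop) (F Q D : {poly S}).

(** A subring, as a predicate; no decidability is required. *)
Definition is_subring K : Prop :=
  [/\ K 1, forall x y, K x -> K y -> K (x - y) &
      forall x y, K x -> K y -> K (x * y)].

(** The subring K[A], as the smallest subring containing K and A. *)
Definition adjoin K A : S -> Prop := fun q =>
  forall K', is_subring K' -> (forall x, K x -> K' x) ->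
    (forall x, A x -> K' x) -> K' q.

Definition coef_in K (p : {poly S}) : Prop := forall i, K p`_i.

(** The K-linear span of a finite family. *)
Definition kspan K (T : finType) (b : T -> S) : S -> Prop := fun q =>
  exists c : T -> S, (forall t, K (c t)) /\ q = \sum_t c t * b t.

Section Closure.
Variable K : S -> Prop.
Hypothesis subK : is_subring K.

Lemma subring1 : K 1. Proof. by case: subK. Qed.
Lemma subringB x y : K x -> K y -> K (x - y).
Proof. by case: subK => _ h _; apply: h. Qed.
Lemma subringM x y : K x -> K y -> K (x * y).
Proof. by case: subK => _ _; apply. Qed.
Lemma subring0 : K 0.
Proof. by rewrite -(subrr 1); apply: subringB; apply: subring1. Qed.
Lemma subringN x : K x -> K (- x).
Proof. by move=> Kx; rewrite -sub0r; apply: subringB => //; apply: subring0. Qed.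
Lemma subringD x y : K x -> K y -> K (x + y).
Proof. by move=> Kx Ky; rewrite -[y]opprK; apply/subringB => //; apply: subringN. Qed.
Lemma subring_sum I (r : seq I) (P : pred I) (f : I -> S) :
  (forall i, P i -> K (f i)) -> K (\sum_(i <- r | P i) f i).
Proof. by move=> h; elim/big_ind: _ => //; [apply: subring0 | apply: subringD]. Qed.
Lemma subring_nat n : K n%:R.
Proof.
by elim: n => [|n IH]; [apply: subring0|rewrite -natr1; apply: subringD => //; apply: subring1].
Qed.

Lemma coef_inB p q : coef_in K p -> coef_in K q -> coef_in K (p - q).
Proof. by move=> hp hq i; rewrite coefB; apply: subringB. Qed.

Lemma coef_inM p q : coef_in K p -> coef_in K q -> coef_in K (p * q).
Proof.
by move=> hp hq i; rewrite coefM; apply: subring_sum => j _; apply: subringM.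
Qed.

Lemma coef_in1 : coef_in K 1.
Proof. by move=> i; rewrite coef1; apply: subring_nat. Qed.

Lemma coef_in_prod I (r : seq I) (P : pred I) (f : I -> {poly S}) :
  (forall i, P i -> coef_in K (f i)) -> coef_in K (\prod_(i <- r | P i) f i).
Proof.
move=> h; elim/big_ind: _ => //; first exact: coef_in1.
exact: coef_inM.
Qed.

Lemma adjoin_subring A : is_subring (adjoin K A).
Proof.
split=> [|x y Hx Hy|x y Hx Hy] K' sK' h1 h2.
- by case: sK'.
- by case: (sK') => _ + _; apply; [apply: Hx|apply: Hy].
- by case: (sK') => _ _; apply; [apply: Hx|apply: Hy].
Qed.

Lemma adjoin_sub A x : K x -> adjoin K A x.
Proof. by move=> Kx K' _ h _; apply: h. Qed.

Lemma adjoin_gen A x : A x -> adjoin K A x.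
Proof. by move=> Ax K' _ _; apply. Qed.

Section Span.
Variables (T : finType) (b : T -> S).

Lemma kspan_gen t : kspan K b (b t).
Proof.
exists (fun u => (u == t)%:R); split=> [u|]; first exact: subring_nat.
by rewrite (bigD1 t) //= eqxx mul1r big1 ?addr0 // => u /negPf ->; rewrite mul0r.
Qed.

Lemma kspanZ c q : K c -> kspan K b q -> kspan K b (c * q).
Proof.
move=> Kc [d [Kd ->]]; exists (fun t => c * d t); split=> [t|].
  exact: subringM.
by rewrite big_distrr /=; apply: eq_bigr => t _; rewrite mulrA.
Qed.

Lemma kspanD p q : kspan K b p -> kspan K b q -> kspan K b (p + q).
Proof.
move=> [c [Kc ->]] [d [Kd ->]]; exists (fun t => c t + d t); split=> [t|].
  exact: subringD.
by rewrite -big_split /=; apply: eq_bigr => t _; rewrite mulrDl.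
Qed.

Lemma kspan0 : kspan K b 0.
Proof.
exists (fun=> 0); split=> [t|]; first exact: subring0.
by rewrite big1 // => t _; rewrite mul0r.
Qed.

Lemma kspan_sum I (r : seq I) (P : pred I) (f : I -> S) :
  (forall i, P i -> kspan K b (f i)) -> kspan K b (\sum_(i <- r | P i) f i).
Proof. by move=> h; elim/big_ind: _ => //; [apply: kspan0 | apply: kspanD]. Qed.

End Span.

Lemma kspan_trans (T T' : finType) (b : T -> S) (b' : T' -> S) :
  (forall t, kspan K b' (b t)) -> forall q, kspan K b q -> kspan K b' q.
Proof.
by move=> h q [c [Kc ->]]; apply: kspan_sum => t _; apply: kspanZ.
Qed.

(** Exact division by a monic polynomial does not leave the coefficient ring. *)
Lemma coef_in_divl F Q :
  F \is monic -> coef_in K F -> coef_in K (F * Q) -> coef_in K Q.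
Proof.
move=> mF KF KFQ.
suff H m i : (size Q <= i + m)%N -> K Q`_i.
  by move=> i; apply: (H (size Q)); apply: leq_addl.
elim: m i => [|m IH] i.
  by rewrite addn0 => h; rewrite nth_default //; apply: subring0.
have aux a c : (size Q <= i + m.+1)%N -> (a < c)%N -> (size Q <= i + c - a + m)%N.
  by move: (size Q) => sQ; lia.
move=> hi; have := KFQ (i + (size F).-1)%N.
rewrite coefM.
have hk : ((size F).-1 < (i + (size F).-1).+1)%N by rewrite ltnS leq_addl.
rewrite (bigD1 (Ordinal hk)) //= addnK.
rewrite -[F`_(size F).-1]/(lead_coef F) (monicP mF) mul1r.
set s := \sum_(_ < _ | _) _ => h.
rewrite -[Q`_i](addrK s); apply: subringB => //.
apply: subring_sum => j; rewrite -val_eqE /= => hj.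
have [ltj|] := ltnP j (size F).-1.
  apply: subringM; [exact: KF|apply: IH; exact: aux].
rewrite leq_eqVlt eq_sym (negPf hj) /= => ltj.
by rewrite nth_default ?mul0r; [apply: subring0|exact: leq_trans (leqSpred _) ltj].
Qed.

End Closure.
End Subrings.

(** The Cauchy-Binet formula before the terms are grouped by sets of columns. *)
Lemma det_mulmx_expand (S : comNzRingType) (k n : nat)
    (A : 'M[S]_(k, n)) (B : 'M[S]_(n, k)) :
  \det (A *m B) =
    \sum_(g : {ffun 'I_k -> 'I_n}) (\prod_i A i (g i)) * \det (rowsub g B).
Proof.
rewrite /determinant.
transitivity (\sum_(s : 'S_k) \sum_(g : {ffun 'I_k -> 'I_n})
   (-1) ^+ s * \prod_i (A i (g i) * B (g i) (s i))).
  apply: eq_bigr => s _; rewrite -big_distrr /=; congr (_ * _).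
  under eq_bigr do rewrite mxE.
  by rewrite bigA_distr_bigA.
rewrite exchange_big /=; apply: eq_bigr => g _; rewrite big_distrr /=.
apply: eq_bigr => s _; rewrite big_split /= mulrCA; congr (_ * (_ * _)).
by apply: eq_bigr => i _; rewrite mxE.
Qed.

Section Minors.
Variables (S : comNzRingType) (F Q : {poly S}).
Hypotheses (mF : F \is monic) (mQ : Q \is monic).
Let D := F * Q.
Let k := (size F).-1.
Let n := (size D).-1.
Let C : 'M[S]_k := companionmx F.
Let A : 'M[S]_n := companionmx D.

(** The row of coefficients of the remainder of 'X^b modulo F. *)
Fixpoint redrow (b : nat) : 'rV[S]_k :=
  if b is b'.+1 then redrow b' *m C else \row_j (j == 0%N :> nat)%:R.

(** The matrix, in the bases of powers of 'X, of the projection of the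
    polynomials modulo D onto the polynomials modulo F. *)
Definition redmx : 'M[S]_(n, k) := \matrix_(b < n) redrow b.

Lemma redrow_small b : (b < k)%N -> redrow b = \row_j (j == b :> nat)%:R.
Proof.
elim: b => [//|b IH] ltbk; rewrite /= IH; last exact: ltnW.
apply/rowP => j; rewrite !mxE (bigD1 (Ordinal (ltnW ltbk))) //= !mxE eqxx mul1r.
rewrite big1 ?addr0; last first.
  by move=> i; rewrite -val_eqE /= mxE => /negPf ->; rewrite mul0r.
case: eqP => [e|_]; last by rewrite eq_sym.
have : (k.-1.+1 < k)%N by rewrite -e.
by move=> h; have := leq_trans h (leqSpred _); rewrite ltnn.
Qed.

Lemma size_left_factor : size F = k.+1.
Proof. by rewrite /k prednK // size_poly_gt0 monic_neq0. Qed.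

Lemma size_product : size D = (k + (size Q).-1).+1.
Proof.
rewrite size_monicM ?monic_neq0 // size_left_factor addSn /=.
by have := size_poly_gt0 Q; rewrite monic_neq0 //; case: (size Q) => //= m; rewrite addnS.
Qed.

Lemma redrow_F b : \sum_(s < k.+1) F`_s *: redrow (s + b)%N = 0.
Proof.
elim: b => [|b IH]; last first.
  transitivity ((\sum_(s < k.+1) F`_s *: redrow (s + b)%N) *m C).
    rewrite mulmx_suml; apply: eq_bigr => s _.
    by rewrite addnS /= scalemxAl.
  by rewrite IH mul0mx.
rewrite big_ord_recr /=.
have -> : F`_k = 1 by exact: (monicP mF).
rewrite scale1r addn0.
apply/rowP => j; rewrite !mxE summxE.
have lek : (k.-1 < k)%N by case: (k) j => [[]|] //.
have -> : redrow k 0 j = - F`_j.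
  have e : k = k.-1.+1 by rewrite prednK // (leq_ltn_trans _ lek).
  have rk (b c : nat) : b.+1 = c -> redrow c = redrow b *m C by move=> <-.
  rewrite (rk _ _ (esym e)) redrow_small // mxE.
rewrite (bigD1 (Ordinal lek)) //= !mxE /= !eqxx mul1r big1 ?addr0 //.
  by move=> i; rewrite -val_eqE /= mxE => /negPf ->; rewrite mul0r.
rewrite (bigD1 j) //= addn0 redrow_small // !mxE eqxx mulr1 big1 ?addr0 ?subrr //.
move=> i; rewrite -val_eqE addn0 redrow_small // !mxE eq_sym => /negPf ->.
by rewrite mulr0.
Qed.

Lemma redrow_D : \sum_(s < n.+1) D`_s *: redrow s = 0.
Proof.
have en : n = (k + (size Q).-1)%N by rewrite /n size_product.
transitivity (\sum_(b < size Q) Q`_b *: \sum_(s < k.+1) F`_s *: redrow (s + b)%N).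
  transitivity (\sum_(b < size Q) \sum_(s < n.+1) (Q`_b * (F * 'X^b)`_s) *: redrow s).
    rewrite exchange_big /=; apply: eq_bigr => s _; rewrite -scaler_suml.
    congr (_ *: _); rewrite /D -{1}[Q]coefK poly_def big_distrr /= coef_sum.
    by apply: eq_bigr => b _; rewrite -scalerAr coefZ.
  apply: eq_bigr => b _; rewrite scaler_sumr.
  have hb' : (b + k <= n)%N.
    rewrite en addnC leq_add2l -ltnS; exact: leq_trans (ltn_ord b) (leqSpred _).
  have hb : (k.+1 <= n.+1 - b)%N.
    by rewrite leq_subRL ?addnS // leqW // (leq_trans (leq_addr _ _) hb').
  pose f s := (Q`_b * (F * 'X^b)`_s) *: redrow s.
  rewrite -(big_mkord xpredT f) (big_cat_nat (n := b)) //=; last first.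
    by apply: leqW; apply: leq_trans (leq_addr _ _) hb'.
  rewrite big_nat_cond big1 ?add0r; last first.
    by move=> s /andP[/andP[_ lts] _]; rewrite /f coefMXn lts mulr0 scale0r.
  rewrite -{1}[b : nat]add0n big_addn big_mkord.
  rewrite (big_ord_widen _ (fun s => Q`_b *: (F`_s *: redrow (s + b)%N)) hb).
  rewrite [RHS]big_mkcond /=; apply: eq_bigr => s _.
  rewrite /f coefMXn ltnNge leq_addl /= addnK scalerA.
  case: ifP => // /negbT; rewrite -leqNgt -size_left_factor => h.
  by rewrite (nth_default _ h) mulr0 scale0r.
by apply: big1 => b _; rewrite redrow_F scaler0.
Qed.

(** Multiplication by 'X commutes with reduction modulo F. *)
Lemma redmx_companion : redmx *m C = A *m redmx.
Proof.
apply/row_matrixP => b; rewrite !row_mul rowK -/(redrow b.+1).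
rewrite mulmx_sum_row; under eq_bigr do rewrite mxE rowK mxE.
have [eb|neb] := eqVneq (b : nat) n.-1; last first.
  have ltb : (b.+1 < n)%N by case: b neb => b /= ltb; move/eqP; lia.
  rewrite (bigD1 (Ordinal ltb)) //= eqxx scale1r big1 ?addr0 // => i.
  by rewrite -val_eqE /= eq_sym => /negPf ->; rewrite scale0r.
have en : b.+1 = n by rewrite eb prednK //; apply: leq_ltn_trans (ltn_ord b).
have := redrow_D; rewrite big_ord_recr /=.
have -> : D`_n = 1 by have: D \is monic; [rewrite monicMl | move/monicP].
have -> : redrow n = redrow b *m C by rewrite -[redrow b *m C]/(redrow b.+1) en.
rewrite scale1r => /eqP; rewrite addrC addr_eq0 => /eqP ->.
rewrite -sumrN.
by apply: eq_bigr => i _; rewrite scaleNr.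
Qed.

(** This is the coefficient of degree s in \det (U_g (X - C)) = \det U_g * F,
    where U_g (X - C) is rewritten as a multiple of redmx. *)
Lemma coef_F_det (g : {ffun 'I_k -> 'I_n}) s :
  F`_s * \det (rowsub g redmx) =
  \sum_(h : {ffun 'I_k -> 'I_n})
    (\prod_i ((g i == h i)%:R *: 'X - (A (g i) (h i))%:P))`_s
      * \det (rowsub h redmx).
Proof.
have detC m (B : 'M[S]_m) : \det (map_mx polyC B) = (\det B)%:P.
  by rewrite det_map_mx.
pose P : 'M[{poly S}]_(k, n) :=
  \matrix_(i, l) ((g i == l)%:R *: 'X - (A (g i) l)%:P).
have: map_mx polyC (rowsub g redmx) *m char_poly_mx C = P *m map_mx polyC redmx.
  rewrite /char_poly_mx mulmxBr -map_mxM mul_mx_scalar.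
  have -> : P = 'X *: rowsub g 1%:M - map_mx polyC (rowsub g A).
    by apply/matrixP => i l; rewrite !mxE scaler_nat mulr_natr.
  rewrite mulmxBl -map_mxM -scalemxAl.
  by rewrite !mul_rowsub_mx redmx_companion mul1mx !map_mxsub.
move/(congr1 determinant); rewrite det_mulmx detC det_mulmx_expand.
rewrite -/(char_poly C) companionmxK // => /(congr1 (fun p : {poly S} => p`_s)).
rewrite coefCM mulrC => ->; rewrite coef_sum; apply: eq_bigr => h _.
rewrite -map_mxsub detC coefMC; congr (_`_s * _).
by under eq_bigr do rewrite mxE.
Qed.

Variable K : S -> Prop.
Hypotheses (subK : is_subring K) (KD : coef_in K D).

(** The set of coefficients of p. *)
Definition coefs (p : {poly S}) : S -> Prop := fun x => exists i, x = p`_i.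

(** The span of the minors contains 1, and is stable by multiplication by the
    coefficients of F. *)
Lemma adjoin_minors q : adjoin K (coefs F) q ->
  kspan K (fun g : {ffun 'I_k -> 'I_n} => \det (rowsub g redmx)) q.
Proof.
set b := fun g => _.
pose M := kspan K b.
have KA i j : K (A i j).
  rewrite mxE; case: ifP => _; last exact: subring_nat.
  by apply: subringN => //; apply: KD.
have le_kn : (k <= n)%N by rewrite /n size_product leq_addr.
have M1 : M 1.
  have -> : 1 = b [ffun i => widen_ord le_kn i]; last exact: kspan_gen.
  rewrite /b -[LHS](det1 _ k); congr (\det _).
  apply/matrixP => i j; rewrite !mxE ffunE /= redrow_small // mxE.
  by rewrite eq_sym.
move=> /(_ (fun x => forall y, M y -> M (x * y))) h.
rewrite -[q]mulr1; apply: h (M1).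
- split=> [y|x1 x2 h1 h2 y hy|x1 x2 h1 h2 y hy].
  + by rewrite mul1r.
  + rewrite mulrBl -mulN1r; apply: kspanD => //; first exact: h1.
    apply: kspanZ => //; last exact: h2.
    by apply: subringN => //; apply: subring1.
  + by rewrite -mulrA; apply: h1; apply: h2.
- by move=> x Kx y; apply: kspanZ.
- move=> _ [s ->] y [c [Kc ->]]; rewrite big_distrr /=.
  apply: kspan_sum => // g _; rewrite mulrCA; apply: kspanZ => //.
  rewrite coef_F_det; apply: kspan_sum => // g' _; apply: kspanZ => //.
    apply: coef_in_prod => // i _; apply: coef_inB => // j.
      rewrite coefZ coefX; apply: subringM => //; exact: subring_nat.
    rewrite coefC; case: ifP => _ //; exact: subring0.
  exact: kspan_gen.
Qed.

(** Up to sign, a nonzero minor depends only on the set of its rows. *)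
Lemma adjoin_subset_minors : exists (T : finType) (b : T -> S),
  #|T| = 'C(n, k) /\
  forall q, adjoin K (coefs F) q -> kspan K b q.
Proof.
pose T := {B : {set 'I_n} | #|B| == k}.
(* An enumeration of B; the choice is irrelevant. *)
pose rep (B : {set 'I_n}) : option {ffun 'I_k -> 'I_n} :=
  [pick g : {ffun 'I_k -> 'I_n} | injectiveb g && (g @: setT == B)].
pose b (t : T) := if rep (val t) is Some g then \det (rowsub g redmx) else 0.
exists T, b; split.
  by rewrite card_sig -[in RHS](card_ord n) -card_draws; apply: eq_card => B; rewrite [RHS]inE.
move=> q /adjoin_minors; apply: kspan_trans => // h.
have [/injectiveP inj_h|/injectiveP ninj] := boolP (injectiveb h); last first.
  have /injectivePn[i [j neij eij]] : ~~ injectiveb h by apply/injectiveP.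
  rewrite (determinant_alternate neij) ?kspan0 //; first exact: kspan0.
  by move=> l; rewrite !mxE eij.
have cB : #|h @: setT| == k by rewrite card_imset // cardsT card_ord.
have := kspan_gen subK b (Sub (h @: setT) cB : T).
rewrite {2}/b SubK /rep; case: pickP => [g /andP[/injectiveP inj_g /eqP im_g]|]; last first.
  by move=> /(_ h); rewrite eqxx andbT => /negP[]; apply/injectiveP.
have hs i : exists j, g j == h i.
  have: h i \in h @: setT by rewrite imset_f.
  by rewrite -im_g => /imsetP[j _ ->]; exists j.
pose s i := xchoose (hs i).
have sE i : g (s i) = h i by apply/eqP; rewrite (xchooseP (hs i)).
have inj_s : injective s.
  by move=> i j e; apply: inj_h; rewrite -!sE e.
have -> : rowsub h redmx = row_perm (perm inj_s) (rowsub g redmx).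
  by apply/matrixP => i j; rewrite !mxE permE sE.
rewrite row_permE det_mulmx det_perm => hb; apply: kspanZ => //.
by case: (odd_perm _); rewrite ?expr0 ?expr1; [apply: subringN|]; rewrite //; apply: subring1.
Qed.

End Minors.

(** The equality of the statement says that the size of the spanning family is
    the multinomial coefficient of the degrees of the factors. *)
Lemma adjoin_coefs_span (S : comNzRingType) (Fs : seq {poly S}) (Q : {poly S})
    (K : S -> Prop) :
  is_subring K -> all (fun F => F \is monic) Fs -> Q \is monic ->
  coef_in K ((\prod_(F <- Fs) F) * Q) ->
  exists (T : finType) (b : T -> S),
    (#|T| * ((\prod_(F <- Fs) ((size F).-1)`!) * ((size Q).-1)`!) =
      ((size ((\prod_(F <- Fs) F) * Q)%R).-1)`!)%N /\
    forall q, adjoin K (fun x => exists2 F, F \in Fs & coefs F x) q ->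
      kspan K b q.
Proof.
move=> + + mQ; elim: Fs K => [|F Fs IH] K subK.
  rewrite !big_nil mul1r => _ KQ; exists unit, (fun=> 1).
  rewrite card_unit !mul1n; split=> // q; apply.
  - split=> [|x y hx hy|x y [c [Kc ->]] [d [Kd ->]]].
    + exact: (kspan_gen subK _ tt).
    + rewrite -mulN1r; apply: kspanD => //; apply: kspanZ => //.
      by apply: subringN => //; apply: subring1.
    + rewrite !(big_pred1 tt) ?mulr1; try by case.
      apply: kspanZ => //; rewrite -[d tt]mulr1; apply: kspanZ => //.
      exact: (kspan_gen subK (fun=> 1) tt).
  - move=> x Kx; rewrite -[x]mulr1; apply: kspanZ => //.
    exact: (kspan_gen subK (fun=> 1) tt).
  - by move=> x [].
rewrite /= => /andP[mF mFs]; rewrite !big_cons -mulrA => KD.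
set D1 := (\prod_(F <- Fs) F) * Q in KD *.
have mD1 : D1 \is monic.
  by rewrite monicMr // big_seq monic_prod // => G; apply: (allP mFs).
set K1 := adjoin K (coefs F).
have subK1 : is_subring K1 by apply: adjoin_subring.
(* The remaining factors are treated over the extension K1. *)
have K1D1 : coef_in K1 D1.
  apply: (@coef_in_divl S K1 subK1 F) => // i.
    by apply: adjoin_gen; exists i.
  exact: adjoin_sub.
have [T1 [b1 [cT1 h1]]] := adjoin_subset_minors mF mD1 subK KD.
have [T2 [b2 [cT2 h2]]] := IH K1 subK1 mFs K1D1.
exists (T1 * T2)%type, (fun t => b1 t.1 * b2 t.2); split.
  rewrite card_prod.
  have sD : (size (F * D1)).-1 = ((size F).-1 + (size D1).-1)%N by rewrite size_product.
  rewrite cT1 sD -(bin_fact (leq_addr _ _)) addKn -cT2 -!mulnA; congr (_ * _)%N.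
  by rewrite mulnCA; congr (_ * _)%N; rewrite mulnCA.
move=> q hq; have /h2 : adjoin K1 (fun x => exists2 F, F \in Fs & coefs F x) q.
  apply: hq.
  - exact: adjoin_subring.
  - by move=> x Kx; apply: adjoin_sub; apply: adjoin_sub.
  - move=> x [F']; rewrite inE => /orP[/eqP-> hx|hF hx].
      by apply: adjoin_sub; apply: adjoin_gen.
    by apply: adjoin_gen; exists F'.
move=> [c [Kc ->]]; apply: kspan_sum => // t _.
have [d [Kd ->]] := h1 _ (Kc t); rewrite big_distrl; apply: kspan_sum => // u _ /=.
rewrite -mulrA; apply: kspanZ => //.
exact: (kspan_gen subK (fun t => b1 t.1 * b2 t.2) (u, t)).
Qed.

(** * Newton's identities *)

Section PowerSums.
Variable S : comNzRingType.
Implicit Types (F G : {poly S}) (x y : S) (xs : seq S).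

(** The divided difference (F - F(x)) / (X - x). *)
Definition divdiff F x : {poly S} :=
  \poly_(b < size F) \sum_(s < size F | (b < s)%N) F`_s * x ^+ (s.-1 - b).

Lemma divdiffP F x : ('X - x%:P) * divdiff F x = F - F.[x]%:P.
Proof.
have -> : divdiff F x = \sum_(s < size F) F`_s *: \sum_(i < s) 'X^(s.-1 - i) * x%:P ^+ i.
  apply/polyP => b; rewrite coef_poly coef_sum; case: ifP => hb; last first.
    rewrite big1 // => s _; rewrite coefZ coef_sum big1 ?mulr0 // => i _.
    rewrite -polyC_exp coefMC coefXn; case: eqP => [e|]; last by rewrite mul0r.
    move: hb; rewrite e; case: s i {e} => s hs [i /= hi] /negbT h; exfalso.
    by move: (size F) hs h => N *; lia.
  rewrite big_mkcond; apply: eq_bigr => s _; rewrite coefZ coef_sum.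
  case: ifP => hbs; last first.
    rewrite big1 ?mulr0 // => i _; rewrite -polyC_exp coefMC coefXn.
    case: eqP => [e|]; last by rewrite mul0r.
    move: hbs; rewrite e; case: s i {e} => s hs [i /= hi] /negbT h; exfalso.
    by move: (size F) hs h => N *; lia.
  congr (_ * _).
  have hi : (s.-1 - b < s)%N by case: s hbs => s hs /=; lia.
  rewrite (bigD1 (Ordinal hi)) //= big1 ?addr0 => [|i].
    rewrite -polyC_exp coefMC coefXn.
    by rewrite subKn ?eqxx ?mul1r //; case: s hbs {hi} => s hs /=; lia.
  rewrite -val_eqE /= => /eqP ne; rewrite -polyC_exp coefMC coefXn.
  case: eqP => [e|]; last by rewrite mul0r.
  by case: ne; rewrite e subKn // -ltnS; apply: leq_trans (ltn_ord i) (leqSpred _).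
rewrite big_distrr /=.
under eq_bigr => s _ do rewrite -scalerAr -subrXX -polyC_exp scalerBr.
rewrite sumrB -poly_def coefK; congr (_ - _).
rewrite horner_coef rmorph_sum; apply: eq_bigr => s _.
by rewrite /= rmorphM /= mul_polyC.
Qed.

Lemma divdiff_uniq F x H : ('X - x%:P) * H = F - F.[x]%:P -> divdiff F x = H.
Proof.
have reg : GRing.lreg ('X - x%:P : {poly S}).
  by apply: lreg_lead; rewrite (monicP (monicXsubC x)); apply: lreg1.
by move=> e; apply: reg; rewrite e divdiffP.
Qed.

Lemma horner_prod_XsubC_root xs x :
  x \in xs -> (\prod_(y <- xs) ('X - y%:P)).[x] = 0.
Proof. by move=> h; rewrite (big_rem x) //= !hornerE subrr mul0r. Qed.

Lemma deriv_prod_XsubC xs :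
  (\prod_(x <- xs) ('X - x%:P))^`() =
    \sum_(x <- xs) divdiff (\prod_(y <- xs) ('X - y%:P)) x.
Proof.
elim: xs => [|y xs IH]; first by rewrite !big_nil -polyC1 derivC.
rewrite !big_cons derivM derivXsubC mul1r {}IH.
set G := \prod_(_ <- _) _.
have step x : divdiff (('X - y%:P) * G) x = ('X - y%:P) * divdiff G x + G.[x]%:P.
  apply: divdiff_uniq; rewrite mulrDr mulrCA divdiffP !hornerE.
  by rewrite polyCM polyCB; ring.
congr (_ + _).
  apply/esym/divdiff_uniq; rewrite !hornerE subrr mul0r subr0 //.
rewrite big_distrr /= big_seq [RHS]big_seq; apply: eq_bigr => x xs_x.
rewrite step [G.[x]](_ : _ = 0) ?addr0 //.
exact: horner_prod_XsubC_root.
Qed.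

(** Newton's identities, in the form: the power sums are integral polynomials in
    the elementary symmetric functions. *)
Lemma power_sum_in (K : S -> Prop) xs a : is_subring K ->
  coef_in K (\prod_(x <- xs) ('X - x%:P)) -> K (\sum_(x <- xs) x ^+ a).
Proof.
move=> subK; set F := \prod_(_ <- _) _ => KF.
have sF : size F = (size xs).+1 by rewrite size_prod_XsubC.
have F1 : F`_(size xs) = 1.
  have /monicP := monic_prod_XsubC xs xpredT id.
  by rewrite lead_coefE -/F sF.
set k := size xs in sF F1.
elim/ltn_ind: a => a IH; have [ltak|leka] := ltnP a k.
  (* The power sum of degree a occurs with coefficient 1 in the coefficient of
     degree b of the derivative of F. *)
  pose b := (k.-1 - a)%N.
  have hb : b = (k - a.+1)%N by rewrite /b; lia.
  have := congr1 (fun p : {poly S} => p`_b) (deriv_prod_XsubC xs).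
  rewrite -/F /= coef_deriv coef_sum => e.
  have: K (F`_b.+1 *+ b.+1) by rewrite -mulr_natr; apply: subringM => //; exact: subring_nat.
  rewrite {}e (eq_bigr (fun x =>
    \sum_(s < k.+1) (b < s)%:R * F`_s * x ^+ (s.-1 - b))); last first.
    move=> x _; rewrite coef_poly sF ifT; last by rewrite hb; lia.
    rewrite big_mkcond; apply: eq_bigr => s _.
    by case: ifP; rewrite ?mul1r ?mul0r.
  rewrite exchange_big big_ord_recr /= F1 mulr1.
  have -> : (b < k)%N by rewrite hb; lia.
  have -> : (k.-1 - b)%N = a by rewrite hb; lia.
  under [X in K (_ + X)]eq_bigr do rewrite mul1r.
  set t := \sum_(s < k) _ => h.
  rewrite -[X in K X](addKr t) addrC; apply: subringB => //.
  apply: subring_sum => // s _; rewrite -big_distrr /=.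
  case: ltnP => [ltbs|_]; last by rewrite !mul0r; apply: subring0.
  rewrite mul1r; apply: subringM => //; apply: IH.
  by have := ltn_ord s; rewrite hb; lia.
(* For a >= k, the sum over x of x^(a - k) F(x) = 0. *)
have : \sum_(s < k.+1) F`_s * \sum_(x <- xs) x ^+ (a - k + s) = 0.
  under eq_bigr do rewrite big_distrr /=.
  rewrite exchange_big big_seq big1 //= => x xs_x.
  have := horner_prod_XsubC_root xs_x; rewrite -/F.
  rewrite horner_coef sF => e.
  transitivity (x ^+ (a - k) * \sum_(s < k.+1) F`_s * x ^+ s).
    rewrite big_distrr; apply: eq_bigr => s _ /=; by rewrite exprD mulrCA.
  by rewrite e mulr0.
rewrite big_ord_recr /= F1 mul1r subnK // => /eqP; rewrite addrC addr_eq0 => /eqP ->.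
apply: subringN => //; apply: subring_sum => // s _; apply: subringM => //.
by apply: IH; have := ltn_ord s; lia.
Qed.

End PowerSums.

(** * Linear spans and the matrix units of sl *)

(** Linear maps of current modules are given by unbundled proofs of linearity;
    these are the basic facts in that form. *)
Section LinearFacts.
Variables (F : nzRingType) (U V : lmodType F) (f : U -> V).
Hypothesis lf : linear f.
Let g : {linear U -> V} := HB.pack f (GRing.isLinear.Build F U V _ f lf).
Lemma lin0 : f 0 = 0. Proof. exact: (linear0 g). Qed.
Lemma linB x y : f (x - y) = f x - f y. Proof. exact: (linearB g). Qed.
Lemma linZ a x : f (a *: x) = a *: f x. Proof. exact: (linearZ_LR g). Qed.
Lemma lin_sum I (s : seq I) (P : pred I) (h : I -> U) :
  f (\sum_(i <- s | P i) h i) = \sum_(i <- s | P i) f (h i).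
Proof. exact: (linear_sum g). Qed.
End LinearFacts.

Section Span.
Variables (F : nzRingType) (V : lmodType F).

Definition is_subspace (U : V -> Prop) : Prop :=
  U 0 /\ forall a u w, U u -> U w -> U (a *: u + w).

(** The linear span of G, as the smallest subspace containing G. *)
Definition lspan (G : V -> Prop) : V -> Prop := fun w =>
  forall U, is_subspace U -> (forall g, G g -> U g) -> U w.

Section Subspace.
Variable U : V -> Prop.
Hypothesis sU : is_subspace U.
Lemma subspace0 : U 0. Proof. by case: sU. Qed.
Lemma subspaceZ a u : U u -> U (a *: u).
Proof. by move=> hu; rewrite -[a *: u]addr0; case: sU => h; apply. Qed.
Lemma subspaceD u w : U u -> U w -> U (u + w).
Proof. by move=> hu hw; rewrite -[u]scale1r; case: sU => _; apply. Qed.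
Lemma subspaceN u : U u -> U (- u).
Proof. by rewrite -scaleN1r; apply: subspaceZ. Qed.
Lemma subspaceB u w : U u -> U w -> U (u - w).
Proof. by move=> hu hw; apply: subspaceD => //; apply: subspaceN. Qed.
Lemma subspace_sum I (s : seq I) (P : pred I) (h : I -> V) :
  (forall i, P i -> U (h i)) -> U (\sum_(i <- s | P i) h i).
Proof. by move=> hP; elim/big_ind: _ => //; [apply: subspace0|apply: subspaceD]. Qed.
End Subspace.

Lemma lspan_subspace G : is_subspace (lspan G).
Proof.
split=> [U [? _] _ //|a u w hu hw U sU hG].
by case: (sU) => _; apply; [apply: hu|apply: hw].
Qed.

Lemma lspan_gen (G : V -> Prop) g : G g -> lspan G g.
Proof. by move=> Gg U _; apply. Qed.

Lemma lspan_mono (G G' : V -> Prop) w :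
  (forall g, G g -> G' g) -> lspan G w -> lspan G' w.
Proof. by move=> h; apply=> [|g /h]; [apply: lspan_subspace|apply: lspan_gen]. Qed.

End Span.

Lemma lspan_map (F : nzRingType) (V W : lmodType F) (f : V -> W) (G : V -> Prop)
    (U : W -> Prop) w :
  linear f -> is_subspace U -> (forall g, G g -> U (f g)) -> lspan G w -> U (f w).
Proof.
move=> lf sU h hw; apply: (hw (fun w => U (f w))) => //; split.
  by rewrite lin0 //; apply: subspace0.
by move=> a u w' hu hw'; rewrite lf; case: sU => _; apply.
Qed.

Section MatrixUnits.
Variables (R : realType) (r : nat).
Local Notation C := R[i].
Local Notation I := 'I_r.+1.
Implicit Types a b c d : I.

Fact unit_sl_subproof a b :
  delta_mx a b - ((a == b)%:R / r.+1%:R)%:M \in @traceless R r.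
Proof.
rewrite unfold_in /traceless raddfB /= mxtrace_scalar subr_eq0.
rewrite /mxtrace (bigD1 a) //= mxE eqxx big1 ?addr0 => [|i /negPf ia].
  by rewrite -[_ / _ *+ _]mulr_natr divfK ?pnatr_eq0 // eq_sym.
by rewrite mxE ia.
Qed.

(** The projection of the matrix unit E_ab to sl.  It makes the bracket formula
    of gl available for all indices, the identity matrix being sent to 0. *)
Definition unit_sl a b : sl R r := Sl (unit_sl_subproof a b).

Lemma bracket_unit a b c d :
  bracket (unit_sl a b) (unit_sl c d) =
    (b == c)%:R *: unit_sl a d - (d == a)%:R *: unit_sl c b.
Proof.
apply: val_inj => /=; rewrite !mulmxBl !mulmxBr.
rewrite !mul_scalar_mx !mul_mx_scalar !mul_delta_mx_cond.
rewrite !scale_scalar_mx ![in RHS]scalerBr !scale_scalar_mx.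
rewrite ![_ *+ (_ == _)]mulrb [c == b]eq_sym [a == d]eq_sym.
rewrite [_ / _ * _ in X in _ - X]mulrC.
case: (b == c); case: (d == a); rewrite ?scale1r ?scale0r ?mul1r ?mul0r;
apply/matrixP => i j; rewrite !mxE; ring.
Qed.

Lemma sl_mx_linear : linear (@sl_mx R r : sl R r -> 'M[C]_r.+1).
Proof. by []. Qed.

Lemma sl_decomp (x : sl R r) : x = \sum_a \sum_b x a b *: unit_sl a b.
Proof.
apply: val_inj; rewrite /= (lin_sum sl_mx_linear).
under eq_bigr => a _.
  rewrite (lin_sum sl_mx_linear); under eq_bigr do rewrite (linZ sl_mx_linear).
  over.
transitivity (\sum_a \sum_b x a b *: delta_mx a b
  - \sum_a \sum_b x a b *: ((a == b)%:R / r.+1%:R)%:M : 'M[C]_r.+1).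
  rewrite -matrix_sum_delta -[LHS]subr0; congr (_ - _).
  rewrite (eq_bigr (fun a => (x a a / r.+1%:R)%:M)); last first.
    move=> a _; rewrite (bigD1 a) //= big1 ?addr0 => [|b /negPf ba].
      by rewrite eqxx scale_scalar_mx mul1r.
    by rewrite eq_sym ba mul0r scale_scalar_mx mulr0 -scalemx1 scale0r.
  rewrite -raddf_sum -mulr_suml /=.
  have /eqP -> : \sum_a x a a == 0 by exact: (valP x).
  by rewrite mul0r -scalemx1 scale0r.
rewrite -sumrB; apply: eq_bigr => a _; rewrite -sumrB; apply: eq_bigr => b _.
by rewrite -scalerBr.
Qed.

Lemma sum_unit_diag : \sum_a unit_sl a a = 0.
Proof.
apply: val_inj; rewrite /= (lin_sum sl_mx_linear) sumrB.
rewrite -mx1_sum_delta; under eq_bigr do rewrite eqxx.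
rewrite sumr_const card_ord -raddfMn /= mul1r -[_ *+ _]mulr_natr mulVf ?subrr //.
by rewrite pnatr_eq0.
Qed.

End MatrixUnits.

(** * Words in commuting operators *)

Section Ladder.
Variables (F : numFieldType) (J : eqType) (W : lmodType F).
Variables (phi D : J -> nat -> W -> W) (v : W).
Hypothesis phi_linear : forall j a, linear (phi j a).
Hypothesis phi_comm : forall j k a b w,
  phi j a (phi k b w) = phi k b (phi j a w).

(** The word phi_(j_1)(a_1) ... phi_(j_m)(a_m) w, for L = (j_1, a_1), ... *)
Definition gword (w : W) (L : seq (J * nat)) : W :=
  foldr (fun p w => phi p.1 p.2 w) w L.

Lemma gword_cat w L1 L2 : gword w (L1 ++ L2) = gword (gword w L2) L1.
Proof. by rewrite /gword foldr_cat. Qed.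

Lemma phi_gword j d w L : phi j d (gword w L) = gword (phi j d w) L.
Proof. by elim: L => //= p L IH; rewrite phi_comm IH. Qed.

Lemma gword_comm w L1 L2 : gword (gword w L2) L1 = gword (gword w L1) L2.
Proof. by elim: L1 => //= p L1 ->; rewrite phi_gword. Qed.

Lemma gword_perm w L1 L2 : perm_eq L1 L2 -> gword w L1 = gword w L2.
Proof.
move=> /(catCA_perm_ind (P := fun s => gword w L1 = gword w s)); apply=> //.
by move=> s1 s2 s3 ->; rewrite !gword_cat gword_comm.
Qed.

Lemma gword_linear L : linear (fun w => gword w L).
Proof. by elim: L => //= p L IH a u w; rewrite IH phi_linear. Qed.

Hypothesis D_comm : forall j k a b w,
  D j a (phi k b w) = phi k b (D j a w) + (j == k)%:R *: phi k (a + b) w.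
Hypothesis D_v : forall j a, (0 < a)%N -> D j a v = 0.

(** Words with exponents 0. *)
Definition zeros (B : seq J) : seq (J * nat) := [seq (j, 0%N) | j <- B].

(** D commutes with a word up to words with the same letters. *)
Lemma D_gword j b y A (U : W -> Prop) : is_subspace U ->
  (forall A', map fst A' = map fst A -> U (gword y A')) ->
  U (D j b (gword y A) - gword (D j b y) A).
Proof.
elim: A U => [|p A IH] U sU hU /=; first by rewrite subrr; apply: subspace0.
rewrite D_comm addrAC -(linB (phi_linear _ _)); apply: (subspaceD sU).
  apply: (IH (fun x => U (phi p.1 p.2 x))) => [|A' eA'].
    split; first by rewrite (lin0 (phi_linear _ _)); apply: subspace0.
    by move=> a u w hu hw; rewrite phi_linear; case: sU => _; apply.
  by apply: (hU (p :: A')); rewrite /= eA'.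
apply: (subspaceZ sU); exact: (hU ((p.1, (b + p.2)%N) :: A)).
Qed.

(** Here D_j(b) acts on each of the letters j in turn, and the resulting words are
    equal since the letters commute. *)
Lemma D_zeros j b B : (0 < b)%N ->
  D j b (gword v (zeros B)) =
    (count_mem j B)%:R *: gword v ((j, b) :: zeros (rem j B)).
Proof.
move=> b0; elim: B => [|k B IH]; first by rewrite /= D_v // scale0r.
rewrite /= D_comm IH addn0 (linZ (phi_linear _ _)) (eq_sym j k).
have [->|nkj] := eqVneq k j; last by rewrite scale0r addr0 /= phi_comm.
rewrite natrD scalerDl addrC; congr (_ + _) => //=.
have [jB|jB] := boolP (j \in B); last by rewrite (count_memPn jB) !scale0r.
rewrite phi_comm; congr (_ *: phi j b _).
apply: (@gword_perm _ ((j, 0%N) :: zeros (rem j B))).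
by rewrite perm_sym; apply: (perm_map (fun j : J => (j, 0%N)) (perm_to_rem jB)).
Qed.

(** A D-stable subspace containing a word with zero exponents contains all the
    words with the same letters.  The induction is on the number of letters of A,
    those whose exponents are not required to be zero. *)
Lemma stable_subspace_words (U : W -> Prop) : is_subspace U ->
  (forall j a w, (0 < a)%N -> U w -> U (D j a w)) ->
  forall A B, U (gword v (zeros (map fst A ++ B))) ->
  U (gword v (A ++ zeros B)).
Proof.
move=> sU DU A; move eN: (size A) => N.
elim: N A eN => [|N IH] [|[j b] A] //= [eN] B hB.
have eqj : gword v (A ++ zeros (j :: B)) = gword v (((j, 0%N) :: A) ++ zeros B).
  by apply: gword_perm; rewrite /zeros /= perm_catC /= perm_cons perm_catC.
have hj : forall A', map fst A' = map fst A -> U (gword v (A' ++ zeros (j :: B))).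
  move=> A' eA'; apply: IH; first by rewrite -(size_map fst) eA' size_map.
  rewrite eA' (@gword_perm _ _ (zeros (j :: map fst A ++ B))) //.
  by apply: perm_map; rewrite -cat1s perm_catCA.
case: (posnP b) => [b0|b0]; first by move: (hj A erefl); rewrite eqj b0.
(* Up to elements of U, D_j(b) only acts on the letters of j :: B; this gives a
   positive multiple of the word with the additional letter (j, b). *)
have h : U (D j b (gword (gword v (zeros (j :: B))) A)
              - gword (D j b (gword v (zeros (j :: B)))) A).
  by apply: D_gword => // A' eA'; rewrite -gword_cat; apply: hj.
have := subspaceB sU (DU j b _ b0 (hj A erefl)) h.
rewrite gword_cat subKr D_zeros // (linZ (gword_linear _)) /= eqxx.
set x := gword _ A => hx.
have -> : phi j b (gword v (A ++ zeros B)) = x.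
  by rewrite gword_cat phi_gword.
rewrite -[x]scale1r -(@mulVf _ (1 + count_mem j B)%:R) -?scalerA.
  by apply: subspaceZ.
by rewrite pnatr_eq0.
Qed.

End Ladder.

(** * Matrix units with coefficients acting on a current module *)

Section Calculus.
Variables (R : realType) (r : nat) (V : current_module R r).
Local Notation C := R[i].
Local Notation I := 'I_r.+1.
Implicit Types (a b : I) (v w : V) (j : 'I_r).

(** The action of E_ab (x) t^d. *)
Definition eop a b (d : nat) (w : V) : V := cm_act (unit_sl R a b) 'X^d w.

Lemma eop_linear a b d : linear (eop a b d).
Proof. exact: cm_linear. Qed.

Lemma cm_actE (x : sl R r) P w :
  cm_act x P w = \sum_a \sum_b \sum_(d < size P) (x a b * P`_d) *: eop a b d w.
Proof.
rewrite {1}[x]sl_decomp (lin_sum (@cm_linear_sl _ _ V P w)).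
apply: eq_bigr => a _; rewrite (lin_sum (@cm_linear_sl _ _ V P w)).
apply: eq_bigr => b _; rewrite (linZ (@cm_linear_sl _ _ V P w)).
rewrite -{1}[P]coefK poly_def (lin_sum (@cm_linear_poly _ _ V _ w)) scaler_sumr.
by apply: eq_bigr => d _; rewrite (linZ (@cm_linear_poly _ _ V _ w)) scalerA.
Qed.

Lemma eop_comm a b c d p q w :
  eop a b p (eop c d q w) = eop c d q (eop a b p w)
    + (b == c)%:R *: eop a d (p + q) w - (d == a)%:R *: eop c b (p + q) w.
Proof.
have := @cm_bracket _ _ V (unit_sl R a b) (unit_sl R c d) 'X^p 'X^q w.
rewrite bracket_unit -exprD (linB (@cm_linear_sl _ _ V _ w)).
rewrite !(linZ (@cm_linear_sl _ _ V _ w)) => h.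
by rewrite -addrA /eop h addrC subrK.
Qed.

Lemma sum_eop_diag d w : \sum_a eop a a d w = 0.
Proof.
rewrite -(lin_sum (@cm_linear_sl _ _ V 'X^d w)) sum_unit_diag.
exact: (lin0 (@cm_linear_sl _ _ V 'X^d w)).
Qed.

(** The lowering operator E_j'0 (x) t^d, where j' = j + 1 as an index from 1 to r. *)
Definition fop j (d : nat) : V -> V := eop (lift ord0 j) ord0 d.

Lemma fop_linear j d : linear (fop j d). Proof. exact: eop_linear. Qed.

Lemma lift0_neq j : (lift ord0 j == ord0 :> I) = false.
Proof. by rewrite eq_sym (negPf (neq_lift _ _)). Qed.

Lemma neq0_lift j : (ord0 == lift ord0 j :> I) = false.
Proof. by rewrite (negPf (neq_lift _ _)). Qed.

Lemma neq0_liftE a : a != ord0 -> exists j, a = lift ord0 j.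
Proof. by case: (unliftP ord0 a) => [j ->|->]; [exists j|rewrite eqxx]. Qed.

Lemma fop_comm j k d e w : fop j d (fop k e w) = fop k e (fop j d w).
Proof. by rewrite /fop eop_comm neq0_lift eq_sym lift0_neq !scale0r subr0 addr0. Qed.

Lemma eop_fop a b j d e w : b != ord0 ->
  eop a b d (fop j e w) = fop j e (eop a b d w)
   + (b == lift ord0 j)%:R *: eop a ord0 (d + e) w
   - (a == ord0)%:R *: eop (lift ord0 j) b (d + e) w.
Proof. by move=> _; rewrite /fop eop_comm [ord0 == a]eq_sym. Qed.

(** Words in the lowering operators applied to v. *)
Definition word (v : V) (L : seq ('I_r * nat)) : V := gword fop v L.

(** The degree in t of a word. *)
Definition deg (L : seq ('I_r * nat)) : nat := sumn (map snd L).

Section HighestWeight.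
Variables (v : V) (lam : I -> nat -> C).

(** The Cartan subalgebra with coefficients in C[t] acts on v by scalars, and v is
    annihilated by E_ab (x) t^d unless a = b or b = 0.  For the first fundamental
    weight, the Levi subalgebra of the indices a, b > 0 also annihilates v. *)
Definition hw_vector : Prop :=
  (forall a b d, a != b -> b != ord0 -> eop a b d v = 0) /\
  (forall a d, eop a a d v = lam a d *: v).

Hypothesis hwv : hw_vector.

(** The filtration by the degree in t. *)
Definition wspan (d : nat) : V -> Prop :=
  lspan (fun w => exists2 L, (deg L <= d)%N & w = word v L).

Lemma wspan_sub d : is_subspace (wspan d). Proof. exact: lspan_subspace. Qed.

Lemma wspan_mono d e w : (d <= e)%N -> wspan d w -> wspan e w.
Proof.
move=> le_de; apply: lspan_mono => g [L hL ->]; exists L => //.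
exact: leq_trans le_de.
Qed.

Lemma wspan_f j d e w : wspan d w -> wspan (d + e) (fop j e w).
Proof.
apply: lspan_map; [exact: fop_linear|exact: wspan_sub|].
move=> g [L hL ->]; apply: lspan_gen; exists ((j, e) :: L) => //=.
by rewrite /deg /= addnC leq_add.
Qed.

Let lift_to (X : nat -> V -> V) :
  (forall e, linear (X e)) ->
  (forall L e, wspan (deg L + e) (X e (word v L))) ->
  forall d e w, wspan d w -> wspan (d + e) (X e w).
Proof.
move=> lX h d e w; apply: lspan_map; [exact: lX|exact: wspan_sub|].
move=> g [L hL ->]; apply: wspan_mono (h L e); by rewrite leq_add.
Qed.

Lemma wspan_v d : wspan d v.
Proof. by apply: lspan_gen; exists [::]. Qed.

Let wspan_levi a b : a != ord0 -> b != ord0 -> forall d e w,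
  wspan d w -> wspan (d + e) (eop a b e w).
Proof.
move=> a0 b0; apply: lift_to => [e|L]; first exact: eop_linear.
elim: L => [|[j d] L IH] e.
  have [<-|neq] := eqVneq a b.
    by rewrite /= (proj2 hwv); apply: (subspaceZ (wspan_sub _)); apply: wspan_v.
  by rewrite /= (proj1 hwv) //; exact: (subspace0 (wspan_sub _)).
rewrite /= eop_fop // (negPf a0) scale0r subr0.
apply: (subspaceD (wspan_sub _)).
  by rewrite /deg /= -addnA addnC; apply: wspan_f; apply: IH.
apply: (subspaceZ (wspan_sub _)).
have [k ->] := neq0_liftE a0; rewrite /deg /=.
rewrite (_ : (_ + _ = deg L + (e + d))%N); last by rewrite /deg; lia.
by apply: wspan_f; apply: lspan_gen; exists L.
Qed.

Let wspan_00 d e w : wspan d w -> wspan (d + e) (eop ord0 ord0 e w).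
Proof.
move: d e w; apply: lift_to => [e|L]; first exact: eop_linear.
elim: L => [|[j d] L IH] e.
  by rewrite /= (proj2 hwv); apply: (subspaceZ (wspan_sub _)); apply: wspan_v.
rewrite /= /fop eop_comm neq0_lift scale0r addr0 eqxx.
apply: (subspaceB (wspan_sub _)).
  by rewrite /deg /= -addnA addnC; apply: wspan_f; apply: IH.
rewrite scale1r /deg /=.
rewrite (_ : (_ + _ = deg L + (e + d))%N); last by rewrite /deg; lia.
by apply: wspan_f; apply: lspan_gen; exists L.
Qed.

(** The words span a submodule, and E_ab (x) t^e raises the filtration by at
    most e.  The brackets with the lowering operators bring E_0b back to the
    Cartan and Levi subalgebras, which are treated first. *)
Lemma wspan_eop a b d e w : wspan d w -> wspan (d + e) (eop a b e w).
Proof.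
have [->|b0] := eqVneq b ord0.
  have [->|a0] := eqVneq a ord0; first exact: wspan_00.
  by have [k ->] := neq0_liftE a0; apply: wspan_f.
have [->|a0] := eqVneq a ord0; last exact: wspan_levi.
move: d e w; apply: lift_to => [e|L]; first exact: eop_linear.
elim: L => [|[j d] L IH] e.
  by rewrite /= (proj1 hwv) // 1?eq_sym //; exact: (subspace0 (wspan_sub _)).
rewrite /= eop_fop // eqxx.
have e1 : (deg ((j, d) :: L) + e = deg L + (e + d))%N by rewrite /deg /=; lia.
apply: (subspaceB (wspan_sub _)).
  apply: (subspaceD (wspan_sub _)).
    by rewrite /deg /= -addnA addnC; apply: wspan_f; apply: IH.
  apply: (subspaceZ (wspan_sub _)).
  by rewrite e1; apply: wspan_00; apply: lspan_gen; exists L.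
apply: (subspaceZ (wspan_sub _)).
rewrite e1; apply: wspan_levi; rewrite ?lift0_neq //.
by apply: lspan_gen; exists L.
Qed.

Lemma generated_words : generated_by v ->
  forall w, lspan (fun w => exists L, w = word v L) w.
Proof.
move=> gen w; apply: gen; last by apply: lspan_gen; exists [::].
split=> [|a u x hu hx|x P u hu].
- by apply: subspace0; apply: lspan_subspace.
- by case: (lspan_subspace (fun w => exists L, w = word v L)) => _; apply.
have sub := lspan_subspace (fun w => exists L, w = word v L).
have incl d y : wspan d y -> lspan (fun w => exists L, w = word v L) y.
  by apply: lspan_mono => g [L _ ->]; exists L.
apply: (lspan_map _ _ _ hu) => // [|g [L ->]]; first exact: cm_linear.
rewrite cm_actE; do 3![apply: (subspace_sum sub) => ? _].
apply: (subspaceZ sub); apply: incl; apply: (@wspan_eop _ _ (deg L) _ _).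
by apply: lspan_gen; exists L.
Qed.

Lemma eop_diag_word a L :
  eop a a 0 (word v L) =
   (lam a 0 + (count (fun p => lift ord0 p.1 == a) L)%:R - (a == ord0)%:R * (size L)%:R)
     *: word v L.
Proof.
elim: L => [|[j d] L IH] /=.
  by rewrite (proj2 hwv) addr0 mulr0 subr0.
rewrite /fop eop_comm IH (linZ (eop_linear _ _ _)) add0n -/(fop j d _).
rewrite [ord0 == a]eq_sym natrD -[(size L).+1]addn1 natrD mulrDr mulr1.
rewrite [a == lift _ _]eq_sym.
have -> : (lift ord0 j == a)%:R *: eop a ord0 d (word v L) =
    (lift ord0 j == a)%:R *: fop j d (word v L).
  by case: eqP => [<-|]; rewrite ?scale0r.
have -> : (a == ord0)%:R *: eop (lift ord0 j) a d (word v L) =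
    (a == ord0)%:R *: fop j d (word v L).
  by case: eqP => [->|]; rewrite ?scale0r.
rewrite -scalerDl -scalerBl; congr (_ *: _); ring.
Qed.

End HighestWeight.
End Calculus.

(** * Consequences of integrability *)

Section SL2.
Variables (R : realType) (r : nat) (V : current_module R r).
Local Notation C := R[i].
Local Notation I := 'I_r.+1.
Implicit Types (a b : I) (v w : V).

Lemma eop0_cm a b w : eop a b 0 w = cm_act (unit_sl R a b) 1 w.
Proof. by []. Qed.

(** An eigenvalue of an element of the Cartan subalgebra is the value of one of the
    finitely many weights of an integrable module. *)
Lemma integrable_eigenvalue (h : sl R r) (k : nat)
    (D : 'I_k -> {ffun 'I_r -> int}) c w :
  (forall v : V, exists! u : {ffun 'I_k -> V},
      (forall i, weight_space (D i) (u i)) /\ v = \sum_(i < k) u i) ->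
  cartan h -> cm_act h 1 w = c *: w -> w != 0 ->
  exists i : 'I_k, c = weight_eval (D i) h.
Proof.
move=> dec ch hw w0.
have [u [[wu su] _]] := dec w.
have [u0 [[_ _] uniq0]] := dec 0.
pose z : {ffun 'I_k -> V} := [ffun i => (weight_eval (D i) h - c) *: u i].
have zero : z = [ffun=> 0].
  rewrite -(uniq0 z); last first.
    split=> [i h' ch'|].
      rewrite ffunE (linZ (@cm_linear _ _ V h' 1)) wu // !scalerA mulrC //.
    under eq_bigr do rewrite ffunE scalerBl.
    rewrite sumrB -scaler_sumr -su -hw {1}su (lin_sum (@cm_linear _ _ V h 1)).
    by apply/esym/eqP; rewrite subr_eq0; apply/eqP; apply: eq_bigr => i _; rewrite -wu.
  apply: uniq0; split=> [i h' ch'|]; last by rewrite big1 // => i; rewrite ffunE.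
  by rewrite ffunE (lin0 (@cm_linear _ _ V h' 1)) scaler0.
have [i ui0] : exists i, u i != 0.
  apply/existsP; apply: contraT; rewrite negb_exists => /forallP h0.
  by case/eqP: w0; rewrite su big1 // => i _; apply/eqP; have := h0 i; rewrite negbK.
exists i; have := congr1 (fun z : {ffun _} => z i) zero; rewrite !ffunE => /eqP.
by rewrite scaler_eq0 (negPf ui0) orbF subr_eq0 => /eqP.
Qed.

(** A nonzero vector of weight c killed by e, in an integrable module of sl_2, has a
    natural number k as its weight and is killed by f^(k+1). *)
Lemma sl2_highest_weight a b w c : integrable_module V -> a != b ->
  eop a b 0 w = 0 -> eop a a 0 w - eop b b 0 w = c *: w -> w != 0 ->
  exists2 k : nat, c = k%:R & iter k.+1 (eop b a 0) w = 0.
Proof.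
move=> [N [D [_ dec]]] ab ew hw w0.
pose f := eop (V := V) b a 0; pose y k := iter k f w.
pose H (x : V) := eop a a 0 x - eop b b 0 x.
have ba : (b == a) = false by rewrite eq_sym (negPf ab).
have Hf x : H (f x) = f (H x) - 2%:R *: f x.
  rewrite /H /f (eop_comm a a b a) (eop_comm b b b a) !eqxx (negPf ab) (linB (eop_linear _ _ _)).
  rewrite !scale0r !scale1r addr0 subr0 scaler_nat mulr2n !opprD !addrA.
  by rewrite [_ - eop b a 0 x - _]addrAC.
have lf : linear f by exact: eop_linear.
have Hy k : H (y k) = (c - (2 * k)%:R) *: y k.
  elim: k => [|k IH]; first by rewrite subr0.
  rewrite /y /= -/(y k) Hf IH (linZ lf) -scalerBl mulnS natrD.
  by congr (_ *: _); ring.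
have ey k : eop a b 0 (y k.+1) = (k.+1%:R * (c - k%:R)) *: y k.
  elim: k => [|k IH].
    rewrite /y /= /f eop_comm ew !eqxx !scale1r (lin0 (eop_linear _ _ _)) add0r.
    by rewrite hw mul1r subr0.
  rewrite [y k.+2]/= {1}/f eop_comm IH !eqxx !scale1r -addrA -/(H (y k.+1)) Hy.
  rewrite (linZ (eop_linear _ _ _)) -/f -/(f (y k)) -/(y k.+1) -scalerDl; congr (_ *: _).
  by rewrite !mulnS !natrD -!natr1; ring.
(* The weights c - 2k are distinct, and finitely many. *)
have [k yk0] : exists k, y k == 0.
  have chH : cartan (unit_sl R a a - unit_sl R b b).
    apply/is_diag_mxP => i j ij /=; rewrite !mxE.
    have neq m : (i == m) && (j == m) = false.
      by apply/negP => /andP[/eqP ei /eqP ej]; move: ij; rewrite ei ej eqxx.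
    have eij : (i == j) = false by rewrite -val_eqE (negPf ij).
    by rewrite !neq eij !mulr0n !subr0.
  have [//|none] := boolP [exists k : 'I_N.+1, y k == 0].
    by move=> /existsP[k ?]; exists k.
  have ex (k : 'I_N.+1) : exists i : 'I_N,
      c - (2 * k)%:R == weight_eval (D i) (unit_sl R a a - unit_sl R b b).
    have yk : y k != 0 by move: none; rewrite negb_exists => /forallP.
    have hk : cm_act (unit_sl R a a - unit_sl R b b) 1 (y k) = (c - (2 * k)%:R) *: y k.
      by rewrite (linB (@cm_linear_sl _ _ V 1 _)); apply: Hy.
    by have [i ei] := integrable_eigenvalue dec chH hk yk; exists i; apply/eqP.
  have : injective (fun k => xchoose (ex k)).
    move=> k1 k2 e; apply: val_inj => /=.
    have /eqP e1 := xchooseP (ex k1); have /eqP e2 := xchooseP (ex k2).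
    move: e1; rewrite e -e2 => /addrI/oppr_inj/eqP; rewrite eqr_nat eqn_mul2l /= => /eqP //.
  by move/leq_card; rewrite !card_ord ltnn.
have ex0 : exists k, y k == 0 by exists k.
case: (ex_minnP ex0) => m ym0 mmin.
case: m ym0 mmin => [|m] ym0 mmin; first by rewrite (negPf w0) in ym0.
exists m; last exact/eqP.
have : y m != 0 by apply/negP => /mmin; rewrite ltnn.
have := ey m; rewrite (eqP ym0) (lin0 (eop_linear _ _ _)) => /esym/eqP.
rewrite scaler_eq0 mulf_eq0 pnatr_eq0 /= => /orP[|->//].
by rewrite subr_eq0 => /eqP.
Qed.

End SL2.

Section WeylGenerator.
Variables (R : realType) (r n : nat) (V : current_module R r).
Local Notation C := R[i].
Local Notation I := 'I_r.+1.
Implicit Types (a b : I).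
Variable v : V.
Hypotheses (intV : integrable_module V)
  (gen : weyl_generator n v).

Lemma coroot_unit_sl (i : 'I_r) :
  coroot R i = unit_sl R (widen_ord (leqnSn r) i) (widen_ord (leqnSn r) i)
    - unit_sl R (lift ord0 i) (lift ord0 i).
Proof. by apply: val_inj; rewrite /= !eqxx opprB addrA subrK. Qed.

(** The eigenvalue on a Weyl generator of the projection of E_aa (x) t^d to sl. *)
Definition weyl_lam (a : I) (d : nat) : C :=
  (d == 0%N)%:R * (n%:R * ((a == ord0)%:R - r.+1%:R^-1)).

Lemma weyl_upper a b d : (a < b)%N -> eop a b d v = 0.
Proof.
move=> ab; case: gen => h _ _; apply: h => i j ji; rewrite !mxE.
have -> : (i == a) && (j == b) = false.
  by apply/negP => /andP[/eqP ia /eqP jb]; move: ji; rewrite ia jb leqNgt ab.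
rewrite [a == b](_ : _ = false) ?mul0r ?mul0rn ?subr0 //.
by apply/negP => /eqP e; rewrite e ltnn in ab.
Qed.

Lemma weyl_diag a d : eop a a d v = weyl_lam a d *: v.
Proof.
have step m (hm : (m < r.+1)%N) : eop (Ordinal hm) (Ordinal hm) d v =
   eop ord0 ord0 d v - ((0 < m)%:R * ((d == 0%N)%:R * n%:R)) *: v.
  elim: m hm => [|m IH] hm.
    rewrite mul0r scale0r subr0; congr (eop _ _ d v); exact: val_inj.
  have hm' : (m < r)%N by [].
  have := IH (leqW hm').
  rewrite (_ : Ordinal (leqW hm') = widen_ord (leqnSn r) (Ordinal hm')); last exact: val_inj.
  rewrite (_ : Ordinal hm = lift ord0 (Ordinal hm')); last exact: val_inj.
  set a0 := widen_ord _ _; set a1 := lift _ _ => e.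
  have : cm_act (coroot R (Ordinal hm')) 'X^d v = ((m == 0%N)%:R * ((d == 0%N)%:R * n%:R)) *: v.
    case: gen => _ h1 h2; case: (posnP m) => m0.
      by rewrite h1 // mul1r hornerXn expr0n mulrC.
    by rewrite h2 // mul0r scale0r.
  rewrite coroot_unit_sl (linB (@cm_linear_sl _ _ V _ _)) -/(eop _ _ _ _) -/(eop _ _ _ _).
  rewrite -/a0 -/a1 e => e'.
  rewrite -[LHS](subKr (eop ord0 ord0 d v - ((0 < m)%:R * ((d == 0%N)%:R * n%:R)) *: v)) e'.
  rewrite mul1r -[LHS]addrA -opprD -scalerDl; congr (_ - _ *: _).
  by case: posnP => _; rewrite /= ?mul0r ?mul1r ?addr0 ?add0r.
have step' b : eop b b d v = eop ord0 ord0 d v - ((b != ord0)%:R * ((d == 0%N)%:R * n%:R)) *: v.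
  by case: b => m hm; rewrite step -val_eqE /= lt0n.
(* The value at a = 0 follows since the projections of the E_aa have sum 0. *)
suff e0 : eop ord0 ord0 d v = weyl_lam ord0 d *: v.
  rewrite step' e0 -scalerBl; congr (_ *: _); rewrite /weyl_lam eqxx.
  by case: (a == ord0); rewrite /=; ring.
have := sum_eop_diag d v; under eq_bigr do rewrite step'.
rewrite sumrB sumr_const card_ord -scaler_suml big_ord_recl eqxx mul0r add0r.
under eq_bigr do rewrite lift0_neq mul1r.
rewrite sumr_const card_ord => /eqP; rewrite subr_eq0 => /eqP e.
have r0 : r.+1%:R != 0 :> C by rewrite pnatr_eq0.
apply: (scalerI r0); rewrite scaler_nat e scalerA; congr (_ *: _).
rewrite /weyl_lam eqxx -[_ *+ r]mulr_natr -natr1.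
rewrite [true%:R]mulr1n; field.
by rewrite natr1.
Qed.

(** For a > b > 0, E_ab (x) t^d v would be a highest weight vector of weight -2
    for the sl_2 of b and a. *)
Lemma weyl_hw : hw_vector v weyl_lam.
Proof.
split=> [a b d neq b0|]; last exact: weyl_diag.
have [ab|ba] := ltnP a b; first exact: weyl_upper.
have {}ba : (b < a)%N by rewrite ltn_neqAle ba andbT eq_sym.
have a0 : a != ord0 by rewrite -val_eqE /= -lt0n (leq_ltn_trans _ ba).
apply/eqP; apply: contraT => w0.
have lam0 c e : c != ord0 -> weyl_lam c e = weyl_lam a e.
  by move=> c0; rewrite /weyl_lam (negPf c0) (negPf a0).
have neq' : b != a by rewrite eq_sym.
have e1 : eop b a 0 (eop a b d v) = 0.
  rewrite eop_comm weyl_upper // (lin0 (eop_linear _ _ _)) add0r !eqxx !scale1r.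
  by rewrite !weyl_diag lam0 // subrr.
have e2 : eop b b 0 (eop a b d v) - eop a a 0 (eop a b d v) = (- 2%:R) *: eop a b d v.
  rewrite (eop_comm b b a b) (eop_comm a a a b) !eqxx (negPf neq') !scale0r !scale1r.
  rewrite !weyl_diag (lam0 b) // addr0 subr0 !opprD addrACA subrr add0r.
  by rewrite scalerBl scaleN1r scale1r.
have [k e _] := sl2_highest_weight intV neq' e1 e2 w0.
have : (2 + k)%:R = 0 :> C by rewrite natrD -e subrr.
by move/eqP; rewrite pnatr_eq0.
Qed.

Lemma weyl_nilp (j : 'I_r) : iter n.+1 (fop (V := V) j 0) v = 0.
Proof.
have [->|v0] := eqVneq v 0.
  by elim: n.+1 => //= m ->; apply: (lin0 (fop_linear _ _)).
have neq : ord0 != lift ord0 j by rewrite neq0_lift.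
have e1 : eop ord0 (lift ord0 j) 0 v = 0 by apply: weyl_upper.
have e2 : eop ord0 ord0 0 v - eop (lift ord0 j) (lift ord0 j) 0 v = n%:R *: v.
  rewrite !weyl_diag -scalerBl /weyl_lam lift0_neq !eqxx; congr (_ *: _).
  by rewrite !mul1r /=; ring.
have [k e h] := sl2_highest_weight intV neq e1 e2 v0.
by have /eqP : n%:R = k%:R :> C := e; rewrite eqr_nat => /eqP ->.
Qed.

End WeylGenerator.

(** * Vanishing of power series of words *)

Lemma sum_triangle (V : nmodType) (H : nat -> nat -> V) s :
  \sum_(a < s.+1) \sum_(b < (s - a).+1) H a b =
  \sum_(a < s.+1) \sum_(b < s.+1 | (a + b <= s)%N) H a b.
Proof.
apply: eq_bigr => a _; have ha := ltn_ord a.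
rewrite (big_ord_widen_cond s.+1 xpredT (H a)) ?ltnS ?leq_subr //.
by apply: eq_bigl => b; rewrite ltnS leq_subRL // -ltnS.
Qed.

(** The formal power series V[[z]], as sequences of coefficients. *)
Definition series (F : numFieldType) (V : lmodType F) : lmodType F :=
  GRing.Lmodule.clone F (nat -> V) _.

Section Convolution.
Variables (F : numFieldType) (V : lmodType F).
Implicit Types (A B : nat -> V -> V) (w : nat -> V).

(** The action of the power series \sum_a A_a z^a of operators on V[[z]]. *)
Definition conv A w : nat -> V := fun s => \sum_(a < s.+1) A a (w (s - a)%N).

Lemma conv_linear A : (forall a, linear (A a)) ->
  linear (conv A : series V -> series V).
Proof.
move=> lA c u w; apply: funext => s; rewrite /conv.
rewrite -[RHS]/(c *: _ + _) scaler_sumr -big_split; apply: eq_bigr => a _ /=.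
exact: (lA a).
Qed.

Lemma conv0 A w : conv A w 0%N = A 0%N (w 0%N).
Proof. by rewrite /conv big_ord1. Qed.

(** If [A_a, B_b] = G_(a+b), then [A(z), B(z)] is the sum of the (e+1) G_e z^e. *)
Lemma conv_comm A B (G : nat -> V -> V) w s :
  (forall a, linear (A a)) -> (forall b, linear (B b)) ->
  (forall a b x, A a (B b x) = B b (A a x) + G (a + b)%N x) ->
  conv A (conv B w) s =
    conv B (conv A w) s + conv (fun e x => e.+1%:R *: G e x) w s.
Proof.
move=> lA lB h.
have cAB A' B' : (forall a, linear (A' a)) -> conv A' (conv B' w) s =
    \sum_(a < s.+1) \sum_(b < s.+1 | (a + b <= s)%N) A' a (B' b (w (s - (a + b))%N)).
  move=> lA'; rewrite -(sum_triangle (fun a b => A' a (B' b (w (s - (a + b))%N)))) /conv.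
  apply: eq_bigr => a _; rewrite lin_sum //.
  by apply: eq_bigr => b _; rewrite subnDA.
rewrite !cAB // [X in _ = X + _](exchange_big_dep xpredT) //=.
rewrite [X in _ = X + _](eq_bigr (fun a : 'I_s.+1 =>
   \sum_(b < s.+1 | (a + b <= s)%N) B b (A a (w (s - (a + b))%N)))); last first.
  by move=> a _; apply: eq_big => [b|b _]; rewrite addnC.
rewrite (_ : conv _ w s = \sum_(a < s.+1) \sum_(b < s.+1 | (a + b <= s)%N)
    G (a + b)%N (w (s - (a + b))%N)).
  rewrite -big_split; apply: eq_bigr => a _; rewrite -big_split.
  by apply: eq_bigr => b _; rewrite h.
rewrite -(sum_triangle (fun a b => G (a + b)%N (w (s - (a + b))%N))) /conv.
pose K e := G e (w (s - e)%N); rewrite -/(K _).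
rewrite (eq_bigr (fun e : 'I_s.+1 => e.+1%:R *: K e)) //.
rewrite [RHS](eq_bigr (fun a : 'I_s.+1 => \sum_(b < (s - a).+1) K (a + b)%N)) //.
elim: (s) K => [|t IH] K; first by rewrite !big_ord1 scale1r.
rewrite big_ord_recr IH [RHS]big_ord_recr /= subnn big_ord1 addn0.
rewrite -[t.+2%:R]natr1 scalerDl scale1r addrA; congr (_ + _).
rewrite [RHS](eq_bigr (fun a : 'I_t.+1 => \sum_(b < (t - a).+1) K (a + b)%N + K t.+1)).
  by rewrite big_split sumr_const card_ord scaler_nat.
move=> a _; rewrite subSn -1?ltnS // big_ord_recr /=.
by rewrite addnS subnKC // -ltnS.
Qed.

Lemma conv_comm0 A B w s :
  (forall a, linear (A a)) -> (forall b, linear (B b)) ->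
  (forall a b x, A a (B b x) = B b (A a x)) ->
  conv A (conv B w) s = conv B (conv A w) s.
Proof.
move=> lA lB h; rewrite (@conv_comm A B (fun _ _ => 0)) // => [|a b x].
  by rewrite [X in _ + X]big1 ?addr0 // => a _; rewrite scaler0.
by rewrite addr0.
Qed.

(** Formal differentiation with respect to z. *)
Definition dser w : nat -> V := fun s => s.+1%:R *: w s.+1.

Lemma dser_conv A w s : (forall a, linear (A a)) ->
  dser (conv A w) s =
    conv (fun a x => a.+1%:R *: A a.+1 x) w s + conv A (dser w) s.
Proof.
move=> lA; rewrite /dser /conv.
transitivity (\sum_(a < s.+2) (a : nat)%:R *: A a (w (s.+1 - a)%N)
  + \sum_(a < s.+2) (s.+1 - a)%:R *: A a (w (s.+1 - a)%N)).
  rewrite -big_split scaler_sumr; apply: eq_bigr => a _ /=.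
  by rewrite -scalerDl -natrD subnKC // -ltnS.
congr (_ + _).
  rewrite big_ord_recl scale0r add0r; apply: eq_bigr => a _.
  by rewrite /= /bump add1n subSS.
rewrite big_ord_recr /= subnn scale0r addr0; apply: eq_bigr => a _.
by rewrite (linZ (lA a)) subSn // -ltnS.
Qed.

End Convolution.

Section Vanishing.
Variables (R : realType) (r n : nat) (V : current_module R r).
Local Notation C := R[i].
Local Notation I := 'I_r.+1.
Variable v : V.
Hypotheses (intV : integrable_module V)
  (gen : weyl_generator n v).
Let hw := weyl_hw intV gen.
Implicit Types (j k : 'I_r).

Local Notation SV := (series V).

(** The constant series v. *)
Definition series0 : SV := fun s => if s == 0%N then v else 0.

(** The action of the series \sum_a z^a f_k (x) t^(a+b). *)
Definition sop k b : SV -> SV := conv (fun a => fop k (b + a)).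

Lemma sop_linear k b : linear (sop k b).
Proof. by apply: conv_linear => a; apply: fop_linear. Qed.

Lemma sop_comm j k a b (w : SV) : sop j a (sop k b w) = sop k b (sop j a w).
Proof.
apply: funext => s; apply: conv_comm0 => *; try exact: fop_linear.
exact: fop_comm.
Qed.

Lemma sop0 k b (w : SV) : sop k b w 0%N = fop k b (w 0%N).
Proof. by rewrite /sop conv0 addn0. Qed.

Section OneRoot.
Variable j : 'I_r.
Let j1 : I := lift ord0 j.
(* The coroot of the sl_2 of 0 and j1, with coefficient t^a. *)
Let H a (x : V) := eop ord0 ord0 a x - eop j1 j1 a x.
(* Z m is f(z)^m v, with f(z) = \sum_a z^a f_j (x) t^a. *)
Let Z m : SV := gword sop series0 (nseq m (j, 0%N)).

Let H_linear a : linear (H a).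
Proof.
move=> c u w; rewrite /H !eop_linear scalerBr opprD !addrA; congr (_ + _).
by rewrite addrAC.
Qed.

Let H_fop a b x : H a (fop j b x) = fop j b (H a x) + (- 2%:R) *: fop j (a + b) x.
Proof.
rewrite /H /fop (eop_comm ord0 ord0) (eop_comm j1 j1) !eqxx /j1 neq0_lift.
rewrite !scale0r !scale1r addr0 subr0 (linB (eop_linear _ _ _)) opprD !addrA.
rewrite scaleNr scaler_nat mulr2n opprD addrA; congr (_ - _).
by rewrite addrAC.
Qed.

Let H_series0 s : H s.+1 v = 0.
Proof. by rewrite /H !(proj2 hw) /weyl_lam !mul0r !scale0r subrr. Qed.

(* The derivative of f(z). *)
Let F' : SV -> SV := conv (fun a x => a.+1%:R *: fop j a.+1 x).

Let scaled_linear (c : nat -> C) (A : nat -> V -> V) :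
  (forall a, linear (A a)) -> forall a, linear (fun x => c a *: A a x).
Proof. by move=> lA a d u w; rewrite lA scalerDr !scalerA mulrC. Qed.

Let Z_S m : Z m.+1 = sop j 0 (Z m). Proof. by []. Qed.

(* With H(z) = \sum_a z^a H_(a+1), the bracket of H(z) and f(z) is -2 f'(z). *)
Let HH_Z m s : conv (fun a => H a.+1) (Z m) s = (- 2%:R) *: dser (Z m) s.
Proof.
elim: m s => [|m IH] s.
  rewrite /dser /Z /= /series0 /= !scaler0 /conv big_ord_recr /= subnn H_series0 addr0.
  apply: big1 => a _; rewrite subn_eq0 leqNgt ltn_ord /=.
  exact: (lin0 (H_linear _)).
rewrite Z_S (@conv_comm _ _ _ _ (fun e x => (- 2%:R) *: fop j e.+1 x)); last first.
- by move=> a b x; rewrite H_fop.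
- by move=> b; apply: fop_linear.
- by move=> a; apply: H_linear.
rewrite dser_conv; last by move=> a; apply: fop_linear.
rewrite scalerDr addrC; congr (_ + _).
  rewrite /conv scaler_sumr; apply: eq_bigr => a _.
  by rewrite !scalerA mulrC.
rewrite {1}/conv [in RHS]/conv scaler_sumr; apply: eq_bigr => a _.
by rewrite IH (linZ (fop_linear _ _)).
Qed.

Let dser_Z m : dser (Z m.+1) = m.+1%:R *: F' (Z m).
Proof.
elim: m => [|m IH]; apply: funext => s.
  rewrite Z_S dser_conv; last by move=> a; apply: fop_linear.
  rewrite -[X in _ + X]/(conv _ _ _) [X in _ + X]big1 ?addr0 -1?[RHS]/(1 *: _) ?scale1r //.
  by move=> a _; rewrite /dser /Z /= /series0 /= scaler0 (lin0 (fop_linear _ _)).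
rewrite Z_S dser_conv; last by move=> a; apply: fop_linear.
have e1 : conv (fun a => fop j (0 + a)) (m.+1%:R *: F' (Z m)) s = m.+1%:R *: F' (Z m.+1) s.
  rewrite -[LHS]/(sop j 0 _ s) (linZ (@sop_linear j 0)).
  rewrite Z_S -[LHS]/(m.+1%:R *: sop j 0 (F' (Z m)) s); congr (_ *: _).
  apply: conv_comm0 => a; first exact: fop_linear.
    exact: (@scaled_linear (fun a => a.+1%:R) (fun a => fop j a.+1) (fun b => fop_linear _ _)).
  by move=> b x; rewrite (linZ (fop_linear _ _)) fop_comm.
rewrite IH e1 -[RHS]/(m.+2%:R *: F' (Z m.+1) s) -[m.+2%:R]natr1 scalerDl scale1r.
by rewrite addrC.
Qed.

(* (E_0j (x) t) f(z)^(m+1) v = - (m+1) d/dz (f(z)^m v). *)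
Let e_Z m s : eop ord0 j1 1 (Z m.+1 s) = (- m.+1%:R) *: dser (Z m) s.
Proof.
have step w t : eop ord0 j1 1 (sop j 0 w t) =
    sop j 0 (fun u => eop ord0 j1 1 (w u)) t + conv (fun a => H a.+1) w t.
  rewrite {1}/sop {1}/conv (lin_sum (eop_linear _ _ _)) /sop /conv -big_split.
  apply: eq_bigr => a _ /=; rewrite add0n /fop eop_comm !eqxx !scale1r add1n.
  by rewrite -addrA.
elim: m s => [|m IH] s.
  rewrite Z_S step HH_Z /dser.
  rewrite [X in X + _]big1 => [|a _]; last first.
    suff -> : eop ord0 j1 1 (Z 0 (s - a)%N) = 0 by apply: (lin0 (fop_linear _ _)).
    rewrite /Z /= /series0; case: eqP => _; last exact: (lin0 (eop_linear _ _ _)).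
    by apply: (proj1 hw); rewrite /j1 ?neq0_lift ?lift0_neq.
  by rewrite add0r /Z /= /series0 /= !scaler0.
rewrite Z_S step HH_Z.
have -> : (fun t => eop ord0 j1 1 (Z m.+1 t)) = (- m.+1%:R) *: (dser (Z m) : SV).
  by apply: funext => t; rewrite IH.
rewrite (linZ (@sop_linear j 0)).
rewrite dser_Z.
have Fd : (m.+1%:R *: sop j 0 (dser (Z m)) s : V) = m%:R *: dser (Z m.+1) s.
  case: m {IH} => [|m].
    rewrite scale0r scale1r; apply: big1 => a _.
    by rewrite /dser /Z /= /series0 /= scaler0 (lin0 (fop_linear _ _)).
  rewrite dser_Z (linZ (@sop_linear j 0)) dser_Z.
  rewrite -[RHS]/(m.+1%:R *: (m.+2%:R *: F' (Z m.+1) s)).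
  rewrite -[LHS]/(m.+2%:R *: (m.+1%:R *: sop j 0 (F' (Z m)) s)) !scalerA mulrC.
  congr (_ *: _); rewrite Z_S.
  apply: conv_comm0 => a; first exact: fop_linear.
    exact: (@scaled_linear (fun a => a.+1%:R) (fun a => fop j a.+1) (fun b => fop_linear _ _)).
  by move=> b x; rewrite (linZ (fop_linear _ _)) fop_comm.
rewrite -dser_Z -[X in X + _]/((- m.+1%:R) *: sop j 0 (dser (Z m)) s) scaleNr Fd.
by rewrite -scaleNr -scalerDl -[m.+2%:R]natr1 -[m.+1%:R]natr1; congr (_ *: _); ring.
Qed.

(** Induction on s from f_j^m v = 0 for m > n: by the preceding formula,
    the coefficient of z^(s+1) in f(z)^m v is a multiple of the image of the
    coefficient of z^s in f(z)^(m+1) v. *)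
Lemma series_root_eq0 m s : (n < m + s)%N -> gword sop series0 (nseq m (j, 0%N)) s = 0.
Proof.
elim: s m => [|s IH] m hm.
  rewrite addn0 in hm.
  have e (q : nat) : gword sop series0 (nseq q (j, 0%N)) 0%N = iter q (fop j 0) v.
    by elim: q => //= q IHq; rewrite sop0 IHq.
  rewrite e -(subnK hm) iterD weyl_nilp //.
  by elim: (_ - _)%N => //= k ->; apply: (lin0 (fop_linear _ _)).
have := e_Z m s; rewrite /Z IH; last by rewrite addSnnS.
rewrite (lin0 (eop_linear _ _ _)) => /esym/eqP.
rewrite scalerA scaler_eq0 mulf_eq0 oppr_eq0 !pnatr_eq0 /= => /eqP //.
Qed.
End OneRoot.

(* E_kj (x) 1 replaces the letters j by k one at a time. *)
Let levi_series (j k : 'I_r) c (t : nat) : k != j ->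
  eop (lift ord0 k) (lift ord0 j) 0 (gword sop series0 (zeros c) t) =
    (count_mem j c)%:R *: gword sop series0 (zeros (k :: rem j c)) t.
Proof.
move=> kj; set X := eop _ _ 0.
have lX : linear X by apply: eop_linear.
have kj1 : lift ord0 k != lift ord0 j :> I by rewrite (inj_eq lift_inj).
have step i b w s : X (sop i b w s) =
    sop i b (fun t => X (w t)) s + (j == i)%:R *: sop k b w s.
  rewrite /sop /conv (lin_sum lX) scaler_sumr -big_split; apply: eq_bigr => a _ /=.
  rewrite /X /fop eop_comm (inj_eq lift_inj) neq0_lift scale0r subr0 add0n //.
elim: c t => [|i c IH] t.
  rewrite /= scale0r /series0; case: eqP => _; last exact: (lin0 lX).
  by apply: (proj1 hw); rewrite ?kj1 ?lift0_neq.
rewrite (_ : count_mem j (i :: c) = ((i == j) + count_mem j c)%N) //.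
rewrite [gword _ _ (zeros (i :: c))]/= step natrD scalerDl addrC (eq_sym j i).
congr (_ + _).
have [->|_] := eqVneq i j; last by rewrite !scale0r.
  by rewrite [rem _ (_ :: _)]/= eqxx.
rewrite [Y in sop i 0 Y t](_ : _ =
    (count_mem j c)%:R *: (gword sop series0 (zeros (k :: rem j c)) : SV)); last first.
  by apply: funext => u; rewrite IH.
rewrite (linZ (@sop_linear i 0)) -[LHS]/(_ *: sop i 0 _ t).
rewrite [rem _ (_ :: _)]/=.
have [-> /=|ij] := eqVneq i j; last by rewrite /= sop_comm.
have [jc|jc] := boolP (j \in c); last by rewrite (count_memPn jc) !scale0r.
congr (_ *: _); rewrite sop_comm; congr (sop k 0 _ t).
have := @gword_perm _ _ _ sop sop_comm series0 (zeros (j :: rem j c)) (zeros c).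
apply; rewrite perm_sym.
exact: (perm_map (fun j : 'I_r => (j, 0%N)) (perm_to_rem jc)).
Qed.

(** The coefficient of z^s in the product over the letters (k, b) of L of the
    series \sum_a z^a f_k (x) t^(a+b), applied to v, is zero as soon as
    size L + s > n.  The Levi subalgebra gives arbitrary letters, and the
    operators E_jj (x) t^a arbitrary exponents. *)
Lemma series_eq0 (L : seq ('I_r * nat)) s :
  (n < size L + s)%N -> gword sop series0 L s = 0.
Proof.
have [j0 _|noj] := pickP 'I_r; last first.
  by case: L => [|[j b] L]; [case: s|have := noj j].
have Z0 (c : seq 'I_r) t : (n < size c + t)%N -> gword sop series0 (zeros c) t = 0.
  move eq : (count (predC1 j0) c) => q; elim: q c eq t => [|q IH] c eq t hc.
    have /all_pred1P ec : all (pred1 j0) c.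
      rewrite all_count eqn_leq count_size leqNgt /= -(count_predC (pred1 j0) c).
      by rewrite -[count (predC _) c]/(count (predC1 j0) c) eq addn0 ltnn.
    by rewrite ec /zeros map_nseq series_root_eq0.
  have /hasP[k kc kj] : has (predC1 j0) c by rewrite has_count eq.
  pose c' := rem k c.
  have pc : perm_eq c (k :: c') := perm_to_rem kc.
  have eq' : count (predC1 j0) (j0 :: c') = q.
    by move: eq; rewrite (seq.permP pc) /= eqxx [_ != _]kj /= => -[].
  have hc' : (n < size (j0 :: c') + t)%N.
    by rewrite /= -[(size c').+1]/(size (k :: c')) -(perm_size pc).
  have := levi_series (j0 :: c') t kj; rewrite IH // (lin0 (eop_linear _ _ _)).
  rewrite [rem _ _]/= eqxx => /esym/eqP; rewrite scaler_eq0 /= eqxx pnatr_eq0 /=.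
  move=> /eqP <-.
  have := @gword_perm _ _ _ sop sop_comm series0 (zeros c) (zeros (k :: c')).
  by move=> -> //; apply: perm_map.
move=> hL.
pose U (w : SV) := forall t, (n < size L + t)%N -> w t = 0.
pose D (j : 'I_r) a (w : SV) : SV := fun t => eop (lift ord0 j) (lift ord0 j) a (w t).
suff : U (gword sop series0 L) by apply.
have := @stable_subspace_words _ _ _ sop D series0 sop_linear sop_comm _ _ U _ _ L [::].
rewrite !cats0; apply.
- move=> j k a b w; apply: funext => t.
  rewrite -[RHS]/(sop k b (D j a w) t + (j == k)%:R *: sop k (a + b) w t).
  rewrite /D /sop /conv (lin_sum (eop_linear _ _ _)) scaler_sumr -big_split.
  apply: eq_bigr => e _ /=; rewrite /fop eop_comm (inj_eq lift_inj) neq0_lift.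
  rewrite scale0r subr0 addnA; congr (_ + _).
  by case: eqP => [->|]; rewrite ?scale0r.
- move=> j a a0; apply: funext => t; rewrite /D /series0.
  case: eqP => _; last exact: (lin0 (eop_linear _ _ _)).
  by rewrite (proj2 hw) /weyl_lam eqn0Ngt a0 mul0r scale0r.
- split=> [t _ //|a u w hu hw' t ht].
  by rewrite -[LHS]/(a *: u t + w t) hu // hw' // scaler0 addr0.
- by move=> j a w a0 Uw t ht; rewrite /D Uw // (lin0 (eop_linear _ _ _)).
- by move=> t ht; apply: Z0; rewrite size_map.
Qed.

Lemma gword_series0 L : gword sop series0 L 0%N = word v L.
Proof. by elim: L => //= p L IH; rewrite sop0 IH. Qed.

Lemma word_eq0 L : (n < size L)%N -> word v L = 0.
Proof. by move=> hL; rewrite -gword_series0 series_eq0 // addn0. Qed.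

End Vanishing.

(** * Upper bound: weight spaces as images of polynomial rings *)

Section MonomialExtension.
Variables (F : comNzRingType) (V : lmodType F) (m : nat) (g : 'X_{1..m} -> V).

(** The linear extension of g from monomials to polynomials. *)
Definition mext (p : {mpoly F[m]}) : V := \sum_(b <- msupp p) p@_b *: g b.

Lemma mextE p s : uniq s -> {subset msupp p <= s} ->
  mext p = \sum_(b <- s) p@_b *: g b.
Proof.
move=> us sub; rewrite [RHS](bigID (mem (msupp p))) /= addrC big1 ?add0r; last first.
  by move=> b /memN_msupp_eq0 ->; rewrite scale0r.
rewrite -big_filter; apply: perm_big; apply: uniq_perm.
- exact: msupp_uniq.
- exact: filter_uniq.
by move=> b; rewrite mem_filter andb_idr //; apply: sub.
Qed.

Lemma mext_linear : linear mext.
Proof.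
move=> a p q; pose s := undup (msupp p ++ msupp q ++ msupp (a *: p + q)).
have us : uniq s := undup_uniq _.
rewrite !(mextE us); first last.
- by move=> b; rewrite mem_undup !mem_cat => ->; rewrite !orbT.
- by move=> b; rewrite mem_undup !mem_cat => ->.
- by move=> b; rewrite mem_undup !mem_cat => ->; rewrite !orbT.
rewrite scaler_sumr -big_split.
by apply: eq_bigr => b _; rewrite mcoeffD mcoeffZ scalerDl scalerA.
Qed.

Lemma mextX b : mext 'X_[b] = g b.
Proof. by rewrite /mext msuppX big_seq1 mcoeffX eqxx scale1r. Qed.

Lemma mext_ind (U : {mpoly F[m]} -> Prop) :
  is_subspace U -> (forall b, U 'X_[b]) -> forall p, U p.
Proof.
by move=> sU h p; rewrite [p]mpolyE; apply: (subspace_sum sU) => b _; apply: (subspaceZ sU).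
Qed.

End MonomialExtension.

Section CompleteSymmetric.
Variables (S : comNzRingType) (I : Type) (x : I -> S).

(** The complete homogeneous symmetric functions of the x_l, for l in A. *)
Fixpoint hsym (A : seq I) (s : nat) : S :=
  if A is l :: A' then \sum_(a < s.+1) x l ^+ a * hsym A' (s - a) else (s == 0%N)%:R.

Lemma hsym0 A : hsym A 0 = 1.
Proof. by elim: A => //= l A IH; rewrite big_ord1 mul1r IH. Qed.

Lemma hsymS l A s : hsym (l :: A) s.+1 = hsym A s.+1 + x l * hsym (l :: A) s.
Proof.
rewrite [LHS]/= big_ord_recl mul1r subn0; congr (_ + _).
rewrite big_distrr; apply: eq_bigr => a _ /=.
by rewrite /bump add1n subSS exprS mulrA.
Qed.

(** The quotient of X^(size A + N) by the product of the X - x_l, for l in A. *)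
Definition hpoly A N : {poly S} := \poly_(i < N.+1) hsym A (N - i).

Lemma size_hpoly A N : size (hpoly A N) = N.+1.
Proof. by rewrite size_poly_eq // subnn hsym0 oner_neq0. Qed.

Lemma hpoly_monic A N : hpoly A N \is monic.
Proof. by rewrite monicE lead_coef_poly // subnn hsym0 ?oner_neq0. Qed.

(** Hence the product of hpoly A N and of the X - x_l is X^(size A + N) up to
    multiples of the h_s of final segments of A. *)
Lemma hpoly_cons l A N :
  ('X - (x l)%:P) * hpoly (l :: A) N = hpoly A N.+1 - (hsym (l :: A) N.+1)%:P.
Proof.
apply/polyP => i; rewrite mulrBl !coefB coefXM coefCM coefC !coef_poly.
case: i => [|i] /=.
  by rewrite !subn0 sub0r -/(hsym (l :: A) N.+1) hsymS opprD addNKr.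
rewrite subr0 subSS !ltnS; case: (ltngtP i N) => [ltiN|ltNi|->].
- rewrite -/(hsym (l :: A) (N - i)).
  have -> : (N - i = (N - i.+1).+1)%N by lia.
  by rewrite hsymS addrK.
- by rewrite mulr0 subr0.
- by rewrite subnn -/(hsym (l :: A) 0) !hsym0 mulr0 subr0.
Qed.

End CompleteSymmetric.

Section TypeBound.
Variables (R : realType) (r n : nat) (V : current_module R r).
Local Notation C := R[i].
Local Notation I := 'I_r.+1.
Variable v : V.
Hypotheses (intV : integrable_module V) (gen : weyl_generator n v).
Let hw := weyl_hw intV gen.
Variables (m : nat) (c : 'I_m -> 'I_r).
Hypothesis le_mn : (m <= n)%N.
Local Notation S := {mpoly C[m]}.

(** The variable x_l stands for the letter c l, and its exponent for a power of t. *)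
Definition letters (b : 'X_{1..m}) (A : seq 'I_m) := [seq (c l, b l) | l <- A].

Definition wordm (b : 'X_{1..m}) : V := word v (letters b (enum 'I_m)).

(** The polynomial ring as a space of linear combinations of words. *)
Definition Phi : S -> V := mext wordm.

Lemma Phi_linear : linear Phi. Proof. exact: mext_linear. Qed.

Lemma letters_shift b l a A : l \notin A -> letters (U_(l) *+ a + b)%MM A = letters b A.
Proof.
move=> lA; apply/eq_in_map => k kA; congr (_, _).
rewrite mnmDE mulmnE mnm1E; case: eqP => [e|_]; last by rewrite mul0n add0n.
by rewrite e kA in lA.
Qed.

(** The letters of A and B play different roles: those of A form a coefficient of a
    power series, and those of B are then applied to it. *)
Lemma Phi_hsym A B s b : enum 'I_m = B ++ A ->
  Phi (hsym (fun l => 'X_l : S) A s * 'X_[b]) =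
   gword (@fop R r V) (gword (@sop R r V) (series0 v) (letters b A) s) (letters b B).
Proof.
elim: A B s b => [|l A IH] B s b eBA.
  rewrite cats0 in eBA; rewrite /= /series0.
  case: eqP => [_|_]; last first.
    by rewrite mul0r (lin0 Phi_linear) (lin0 (gword_linear (@fop_linear R r V) _)).
  by rewrite mul1r /Phi mextX /wordm eBA.
have lBA : uniq (B ++ l :: A) by rewrite -eBA enum_uniq.
have lB : l \notin B.
  by move: lBA; rewrite cat_uniq => /and3P[_ /hasPn h _]; apply: (h l); rewrite mem_head.
have lA : l \notin A.
  by move: lBA; rewrite cat_uniq => /and3P[_ _ /= /andP[]].
rewrite [letters b (l :: A)]/= [gword (@sop R r V) _ (_ :: _)]/= {1}/sop {1}/conv.
rewrite (lin_sum (gword_linear (@fop_linear R r V) _)) [hsym _ _ _]/=.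
rewrite mulr_suml (lin_sum Phi_linear).
apply: eq_bigr => a _.
rewrite [_ ^+ a * _]mulrC -mulrA.
rewrite mpolyXn -mpolyXD (IH (rcons B l)); last by rewrite cat_rcons.
rewrite /letters map_rcons -cats1 gword_cat -!/(letters _ _) !letters_shift //=.
by rewrite mnmDE mulmnE mnm1E eqxx mul1n addnC.
Qed.

Lemma Phi_hsym_eq0 A B s p : enum 'I_m = B ++ A -> (n < size A + s)%N ->
  Phi (hsym (fun l => 'X_l : S) A s * p) = 0.
Proof.
move=> eBA hA; move: p; apply: mext_ind => [|b].
  split; first by rewrite mulr0 (lin0 Phi_linear).
  by move=> a p q hp hq; rewrite mulrDr -scalerAr Phi_linear hp hq scaler0 addr0.
rewrite (Phi_hsym _ _ eBA) (series_eq0 intV gen) ?size_map //.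
exact: (lin0 (gword_linear (@fop_linear R r V) _)).
Qed.

(** The polynomials k such that Phi (k g) is a constant multiple of Phi g. *)
Definition Phi_scalar (k : S) : Prop := exists z : C, forall g, Phi (k * g) = z *: Phi g.

Lemma Phi_scalar_subring : is_subring Phi_scalar.
Proof.
split=> [|k1 k2 [z1 h1] [z2 h2]|k1 k2 [z1 h1] [z2 h2]].
- by exists 1 => g; rewrite mul1r scale1r.
- by exists (z1 - z2) => g; rewrite mulrBl (linB Phi_linear) h1 h2 scalerBl.
- by exists (z1 * z2) => g; rewrite -mulrA h1 h2 scalerA.
Qed.

Lemma Phi_scalar_const (z : C) : Phi_scalar z%:MP.
Proof. by exists z => g; rewrite mul_mpolyC (linZ Phi_linear). Qed.

(** By induction on A, from the expression of hpoly (l :: A) N in terms of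
    hpoly A N.+1. *)
Lemma Phi_scalar_product A B N : enum 'I_m = B ++ A -> (size A + N = n)%N ->
  coef_in Phi_scalar ((\prod_(l <- A) ('X - ('X_l)%:P)) * hpoly (fun l => 'X_l : S) A N).
Proof.
elim: A B N => [|l A IH] B N eBA hN.
  rewrite big_nil mul1r => i; rewrite coef_poly /=.
  case: ifP => _; last exact: (subring0 Phi_scalar_subring).
  exact: (subring_nat Phi_scalar_subring).
rewrite big_cons mulrAC (hpoly_cons (fun l => 'X_l : S)) mulrC mulrBr.
apply: (coef_inB Phi_scalar_subring).
  apply: (IH (rcons B l)); first by rewrite cat_rcons.
  by rewrite -hN addSnnS.
move=> i; rewrite coefMC mulrC; exists 0 => g.
by rewrite -mulrA (Phi_hsym_eq0 _ eBA) ?scale0r // addnS hN.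
Qed.

(** The polynomial whose roots are the variables of letter j. *)
Definition block (j : 'I_r) : {poly S} := \prod_(l | c l == j) ('X - ('X_l)%:P).

Lemma eop_letters j a b A : (0 < a)%N -> uniq A ->
  eop (lift ord0 j) (lift ord0 j) a (word v (letters b A)) =
    \sum_(l <- A | c l == j) word v (letters (U_(l) *+ a + b)%MM A).
Proof.
move=> a0; elim: A => [_|l A IH] /=.
  by rewrite big_nil (proj2 hw) /weyl_lam eqn0Ngt a0 mul0r scale0r.
move=> /andP[lA uA]; rewrite big_cons /fop eop_comm (inj_eq lift_inj) neq0_lift.
rewrite scale0r subr0 IH // -/(fop (c l) (b l) _) (lin_sum (fop_linear _ _)).
have -> : \sum_(k <- A | c k == j)
     fop (c l) (b l) (word v (letters (U_(k) *+ a + b)%MM A)) =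
   \sum_(k <- A | c k == j) word v (letters (U_(k) *+ a + b)%MM (l :: A)).
  rewrite big_seq_cond [RHS]big_seq_cond; apply: eq_bigr => k /andP[kA _].
  rewrite /= mnmDE mulmnE mnm1E; case: eqP => [e|_]; last by rewrite mul0n add0n.
  by rewrite -e kA in lA.
rewrite addrC (eq_sym j); case: eqP => [e|_]; last by rewrite scale0r add0r.
by rewrite scale1r /= mnmDE mulmnE mnm1E eqxx mul1n letters_shift // /fop e.
Qed.

Lemma Phi_psum j a g : (0 < a)%N ->
  Phi ((\sum_(l | c l == j) ('X_l : S) ^+ a) * g) =
    eop (lift ord0 j) (lift ord0 j) a (Phi g).
Proof.
move=> a0; move: g; apply: mext_ind => [|b].
  split; first by rewrite mulr0 !(lin0 Phi_linear) (lin0 (eop_linear _ _ _)).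
  move=> z p q hp hq; rewrite mulrDr -scalerAr !Phi_linear hp hq.
  by rewrite eop_linear.
rewrite mulr_suml (lin_sum Phi_linear) {2}/Phi mextX /wordm.
under eq_bigr do rewrite mpolyXn -mpolyXD /Phi mextX /wordm.
rewrite eop_letters ?enum_uniq // [RHS]big_enum_cond.
by apply: eq_bigl => l; rewrite inE.
Qed.

Lemma blockE j :
  block j = \prod_(x <- [seq 'X_l : S | l <- enum [pred l | c l == j]]) ('X - x%:P).
Proof. by rewrite /block big_map big_enum. Qed.

Lemma size_block j : (size (block j)).-1 = #|[pred l | c l == j]|.
Proof. by rewrite blockE size_prod_XsubC size_map -cardE. Qed.

(** Here n - m is the number of tensor factors left at the index 0. *)
Lemma wordm_span : exists (T : finType) (b : T -> S),
  (#|T| * ((\prod_(j < r) #|[pred l | c l == j]|`!) * (n - m)`!) = n`!)%N /\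
  forall B, lspan (fun w => exists t, w = Phi (b t)) (wordm B).
Proof.
pose Fs := [seq block j | j <- enum 'I_r].
pose Q := hpoly (fun l => 'X_l : S) (enum 'I_m) (n - m).
have prodFs : \prod_(F <- Fs) F = \prod_(l <- enum 'I_m) ('X - ('X_l : S)%:P).
  rewrite big_map big_enum [RHS]big_enum /=.
  by rewrite [RHS](partition_big c xpredT).
have mFs : all (fun F => F \is monic) Fs.
  by apply/allP => _ /mapP[j _ ->]; rewrite blockE monic_prod_XsubC.
have KD : coef_in Phi_scalar ((\prod_(F <- Fs) F) * Q).
  by rewrite prodFs; apply: (Phi_scalar_product (B := [::])); rewrite // size_enum_ord subnKC.
have [T [b [cT hb]]] := adjoin_coefs_span Phi_scalar_subring mFs (hpoly_monic _ _ _) KD.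
exists T, b; split.
  have sz : (size ((\prod_(F <- Fs) F) * Q)).-1 = n.
    rewrite size_monicM ?monic_neq0 ?hpoly_monic //; last first.
      by rewrite prodFs monic_prod_XsubC.
    rewrite prodFs size_prod_XsubC size_enum_ord size_hpoly.
    by rewrite addnS /= subnKC.
  rewrite sz size_hpoly in cT; rewrite -[RHS]cT; congr (_ * (_ * _))%N.
  by rewrite big_map big_enum /=; apply: eq_bigr => j _; rewrite size_block.
move=> B; set G := fun w => _.
pose Kr := adjoin Phi_scalar (fun x => exists2 F, F \in Fs & coefs F x).
have sKr : is_subring Kr by apply: adjoin_subring.
have KrG q : Kr q -> lspan G (Phi q).
  move=> /hb[k [Kk ->]]; rewrite (lin_sum Phi_linear).
  apply: (subspace_sum (lspan_subspace _)) => t _; have [z ->] := Kk t.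
  by apply: (subspaceZ (lspan_subspace _)); apply: lspan_gen; exists t.
(* The image of Kr is stable by the E_jj (x) t^a, and contains the word with
   zero exponents, hence all the words. *)
pose U w := exists2 q, Kr q & w = Phi q.
suff [q Kq ->] : U (wordm B) by apply: KrG.
have sU : is_subspace U.
  split; first by exists 0; [apply: (subring0 sKr)|rewrite (lin0 Phi_linear)].
  move=> z _ _ [p Kp ->] [q Kq ->]; exists (z%:MP * p + q); last first.
    by rewrite mul_mpolyC Phi_linear.
  apply: (subringD sKr) => //; apply: (subringM sKr) => //.
  by apply: adjoin_sub; apply: Phi_scalar_const.
pose D (j : 'I_r) a (w : V) := eop (lift ord0 j) (lift ord0 j) a w.
have := @stable_subspace_words _ _ _ (@fop R r V) D v (@fop_linear R r V)
  (@fop_comm R r V) _ _ U sU _ (letters B (enum 'I_m)) [::].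
rewrite !cats0; apply.
- move=> j k a e w; rewrite /D /fop eop_comm (inj_eq lift_inj) neq0_lift.
  by rewrite scale0r subr0; congr (_ + _); case: eqP => [->|]; rewrite ?scale0r.
- by move=> j a a0; rewrite /D (proj2 hw) /weyl_lam eqn0Ngt a0 mul0r scale0r.
- move=> j a _ a0 [q Kq ->]; rewrite /D -Phi_psum //; eexists; last reflexivity.
  apply: (subringM sKr) => //.
  have := @power_sum_in _ Kr [seq 'X_l : S | l <- enum [pred l | c l == j]] a sKr.
  rewrite -blockE big_map big_enum; apply => i; apply: adjoin_gen.
  by exists (block j); [apply: map_f; rewrite mem_enum|exists i].
- exists 1; first exact: (subring1 sKr).
  have -> : 1 = 'X_[0%MM] :> S by rewrite mpolyX0.
  rewrite /Phi mextX /wordm /letters /zeros -!map_comp; congr (word v _).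
  by apply: eq_map => l /=; rewrite mnm0E.
Qed.

Lemma Phi_weight a p : eop a a 0 (Phi p) =
  (weyl_lam R n a 0 + #|[pred l | lift ord0 (c l) == a]|%:R
     - (a == ord0)%:R * m%:R) *: Phi p.
Proof.
move: p; apply: mext_ind => [|b].
  split; first by rewrite !(lin0 Phi_linear) (lin0 (eop_linear _ _ _)) scaler0.
  move=> z p q hp hq; rewrite !Phi_linear eop_linear hp hq.
  by rewrite scalerDr !scalerA mulrC.
rewrite /Phi mextX /wordm (eop_diag_word hw) size_map size_enum_ord count_map.
rewrite -sum1_card -sum1_count big_enum_cond /=.
by congr ((_ + _%:R - _) *: _); apply: eq_bigl => l; rewrite inE.
Qed.
End TypeBound.

(** * Upper bound: spanning sets of the weight spaces *)

(** A permutation of the first components lifts to a permutation of the pairs. *)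
Lemma perm_lift_map (T1 T2 : eqType) (L : seq (T1 * T2)) (s : seq T1) :
  perm_eq (map fst L) s -> exists2 L', perm_eq L L' & map fst L' = s.
Proof.
elim: s L => [|x s IH] L.
  by move=> /perm_nilP; case: L => //; exists [::].
move=> h; have: x \in map fst L by rewrite (perm_mem h) mem_head.
move=> /mapP[[x' y] pL /= exx]; rewrite -{}exx in pL.
have pr := perm_to_rem pL.
have: perm_eq (map fst (rem (x, y) L)) s.
  rewrite -(perm_cons x); apply: perm_trans h.
  by rewrite perm_sym; apply: (perm_map fst pr).
move=> /IH[L' pL' <-]; exists ((x, y) :: L') => //.
by apply: perm_trans pr _; rewrite perm_cons.
Qed.

Section TypeSpan.
Variables (R : realType) (r n : nat) (V : current_module R r).
Local Notation C := R[i].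
Local Notation I := 'I_r.+1.
Variable v : V.
Hypotheses (intV : integrable_module V) (gen : weyl_generator n v).
Variable i : I -> nat.
Hypothesis sum_i : (\sum_a i a = n)%N.

(** The words with i_j letters j, for all j > 0, are spanned by multinomially many
    vectors of the corresponding weight. *)
Lemma type_span : exists e : 'I_(n`! %/ \prod_a (i a)`!)%N -> V,
  (forall t a, eop a a 0 (e t) = ((i a)%:R - n%:R / r.+1%:R) *: e t) /\
  forall L : seq ('I_r * nat),
    (forall j, count (fun p => p.1 == j) L = i (lift ord0 j)) ->
    lspan (fun w => exists t, w = e t) (word v L).
Proof.
pose cs : seq 'I_r := flatten [seq nseq (i (lift ord0 j)) j | j <- enum 'I_r].
have count_cs j : count_mem j cs = i (lift ord0 j).
  rewrite count_flatten sumnE 2!big_map big_enum (bigD1 j) //= count_nseq /= eqxx mul1n.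
  by rewrite big1 ?addn0 // => k /negPf kj; rewrite count_nseq /= kj.
have size_cs : size cs = (\sum_(j < r) i (lift ord0 j))%N.
  rewrite size_flatten sumnE 2!big_map big_enum; apply: eq_bigr => j _.
  by rewrite size_nseq.
have n_split : n = (i ord0 + size cs)%N by rewrite -sum_i big_ord_recl size_cs.
pose m := size cs; pose c : 'I_m -> 'I_r := tnth (in_tuple cs).
have card_c j : #|[pred l | c l == j]| = i (lift ord0 j).
  rewrite -count_cs -sum1_card -sum1_count.
  rewrite -[X in _ = (\sum_(_ <- X | _) _)%N]/(tval (in_tuple cs)).
  by rewrite -(map_tnth_enum (in_tuple cs)) big_map big_enum_cond.
have le_mn : (m <= n)%N by rewrite n_split leq_addl.
have [T [b [cT hb]]] := wordm_span intV gen c le_mn.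
have {}cT : #|T| = (n`! %/ \prod_a (i a)`!)%N.
  rewrite -cT big_ord_recl mulnC [X in (X * _ %/ _)%N]mulnC.
  rewrite (_ : (n - m)%N = i ord0); last by rewrite n_split addnK.
  under eq_bigr do rewrite card_c.
  by rewrite mulKn // muln_gt0 fact_gt0 prodn_gt0 // => j; apply: fact_gt0.
rewrite -{}cT; exists (fun t => Phi v c (b (enum_val t))); split.
  move=> t a; rewrite (Phi_weight intV gen); congr (_ *: _).
  rewrite /weyl_lam eqxx mul1r.
  have [->|a0] := eqVneq a ord0.
    rewrite eq_card0 => [|l]; last by rewrite !inE lift0_neq.
    rewrite addr0 mul1r n_split natrD -/m mulrBr mulr1; ring.
  have [j ->] := neq0_liftE a0.
  rewrite mul0r subr0 sub0r mulrN addrC; congr (_%:R - _).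
  by rewrite -card_c; apply: eq_card => l; rewrite !inE (inj_eq lift_inj).
move=> L hL.
have: perm_eq (map fst L) cs.
  apply/allP => j _ /=; rewrite count_cs -hL count_map; apply/eqP.
  by apply: eq_count.
move=> /perm_lift_map[L' pL' eL'].
have sL' : size L' == m by rewrite -(size_map fst) eL'.
pose tL := Tuple sL'.
pose B : 'X_{1..m} := [multinom (tnth tL l).2 | l < m].
have -> : word v L = wordm v c B.
  rewrite /word (gword_perm (@fop_comm R r V) _ pL') /wordm /word; congr gword.
  rewrite -[L']/(tval tL) -(map_tnth_enum tL); apply/eq_map => l.
  rewrite mnmE [LHS]surjective_pairing; congr (_, _).
  apply/esym; rewrite /c (tnth_nth (tnth tL l).1) /=.
  transitivity (nth (tnth tL l).1 (map fst L') l); first by rewrite eL'.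
  rewrite (nth_map (tnth tL l)) ?(eqP sL') //.
  by congr (fst _); apply/esym/tnth_nth.
apply: (lspan_mono _ (hb B)) => w [t ->].
by exists (enum_rank t); rewrite enum_rankK.
Qed.

End TypeSpan.

(** * Lower bound: tensor powers of the standard module *)

Section Tensor.
Variables (R : realType) (r n : nat).
Local Notation C := R[i].
Local Notation I := 'I_r.+1.
Local Notation J := {ffun 'I_n -> I}.
Local Notation N := #|{: J}|.
Implicit Types (x y : sl R r) (P Q : {poly C}) (kap mu : J) (F : J -> C).

(** Basis vectors of the tensor power are indexed by functions kap, with kap k the
    index of the factor k; upd replaces the index of the factor k by b. *)
Definition upd kap (k : 'I_n) (b : I) : J := [ffun l => if l == k then b else kap l].

Lemma upd_same kap k b : upd kap k b k = b.
Proof. by rewrite ffunE eqxx. Qed.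

Lemma upd_other kap k b l : l != k -> upd kap k b l = kap l.
Proof. by rewrite ffunE => /negPf ->. Qed.

Lemma upd_upd kap k b b' : upd (upd kap k b) k b' = upd kap k b'.
Proof. by apply/ffunP => l; rewrite !ffunE; case: eqP. Qed.

Lemma upd_comm kap k l b b' : k != l ->
  upd (upd kap k b) l b' = upd (upd kap l b') k b.
Proof.
move=> kl; apply/ffunP => i; rewrite !ffunE.
by case: eqP => [->|//]; rewrite eq_sym (negPf kl).
Qed.

Lemma upd_id kap k : upd kap k (kap k) = kap.
Proof. by apply/ffunP => l; rewrite ffunE; case: eqP => [->|]. Qed.

(** The tensor factor k is evaluated at the point k. *)
Definition pt (k : 'I_n) : C := (k : nat)%:R.

(** The action of x on the factor k, tensors being given by their coordinates. *)
Definition slot x k F kap : C := \sum_b x (kap k) b * F (upd kap k b).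

(** The action of x (x) P on the tensor power. *)
Definition tact x P F kap : C := \sum_k P.[pt k] * slot x k F kap.

Lemma slot_comm x y k l F kap : k != l ->
  slot x k (slot y l F) kap = slot y l (slot x k F) kap.
Proof.
move=> kl; rewrite /slot.
under eq_bigr do rewrite big_distrr /=.
under [RHS]eq_bigr do rewrite big_distrr /=.
rewrite exchange_big; apply: eq_bigr => b _; apply: eq_bigr => a _ /=.
by rewrite upd_comm // !upd_other // 1?eq_sym // mulrCA.
Qed.

Lemma slot_bracket x y k F kap :
  slot (bracket x y) k F kap = slot x k (slot y k F) kap - slot y k (slot x k F) kap.
Proof.
have step x' y' : slot x' k (slot y' k F) kap =
    \sum_b (x' *m y' : 'M_r.+1) (kap k) b * F (upd kap k b).
  rewrite /slot; under eq_bigr do rewrite big_distrr /=.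
  rewrite exchange_big; apply: eq_bigr => b _ /=; rewrite mxE mulr_suml.
  by apply: eq_bigr => a _; rewrite upd_same upd_upd mulrA.
rewrite !step -sumrB; apply: eq_bigr => b _.
by rewrite /= mxE [X in _ + X]mxE mulrBl.
Qed.

Lemma slot_sum x k (T : finType) (G : T -> J -> C) kap :
  slot x k (fun mu => \sum_t G t mu) kap = \sum_t slot x k (G t) kap.
Proof.
rewrite /slot exchange_big; apply: eq_bigr => b _.
by rewrite big_distrr.
Qed.

Lemma slotZ x k c F kap : slot x k (fun mu => c * F mu) kap = c * slot x k F kap.
Proof. by rewrite /slot big_distrr; apply: eq_bigr => b _; rewrite /= mulrCA. Qed.

Lemma tact_tact x y P Q F kap : tact x P (tact y Q F) kap =
  \sum_k \sum_l P.[pt k] * Q.[pt l] * slot x k (slot y l F) kap.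
Proof.
apply: eq_bigr => k _; rewrite /tact slot_sum big_distrr; apply: eq_bigr => l _ /=.
by rewrite slotZ mulrA.
Qed.

Lemma tact_bracket x y P Q F kap : tact (bracket x y) (P * Q) F kap =
  tact x P (tact y Q F) kap - tact y Q (tact x P F) kap.
Proof.
rewrite !tact_tact [X in _ - X]exchange_big -sumrB; apply: eq_bigr => k _.
rewrite -sumrB (bigD1 k) //= big1 ?addr0 => [|l lk].
  by rewrite hornerM slot_bracket [Q.[_] * _]mulrC -mulrBr.
by rewrite slot_comm 1?eq_sym // [Q.[_] * _]mulrC subrr.
Qed.

(** The space of tensors is realized as a space of row vectors. *)
Definition fun_of_rV (u : 'rV[C]_N) : J -> C := fun kap => u 0 (enum_rank kap).

Definition tensor_act x P (u : 'rV[C]_N) : 'rV[C]_N :=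
  \row_i tact x P (fun_of_rV u) (enum_val i).

Lemma fun_of_tensor_act x P u kap :
  fun_of_rV (tensor_act x P u) kap = tact x P (fun_of_rV u) kap.
Proof. by rewrite /fun_of_rV mxE enum_rankK. Qed.

Lemma eq_tact x P F G : F =1 G -> tact x P F =1 tact x P G.
Proof.
move=> FG kap; apply: eq_bigr => k _; congr (_ * _); apply: eq_bigr => b _.
by rewrite FG.
Qed.

Fact tensor_linear_sl P u : linear (fun x => tensor_act x P u).
Proof.
move=> a x y; apply/rowP => i; rewrite !mxE /tact big_distrr -big_split.
apply: eq_bigr => k _; rewrite /= mulrCA -mulrDr; congr (_ * _).
rewrite /slot big_distrr -big_split; apply: eq_bigr => b _ /=.
by rewrite !mxE mulrDl mulrA.
Qed.

Fact tensor_linear_poly x u : linear (fun P => tensor_act x P u).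
Proof.
move=> a P Q; apply/rowP => i; rewrite !mxE /tact big_distrr -big_split.
by apply: eq_bigr => k _; rewrite /= hornerD hornerZ mulrDl mulrA.
Qed.

Fact tensor_linear x P : linear (tensor_act x P).
Proof.
move=> a u w; apply/rowP => i; rewrite !mxE /tact big_distrr -big_split.
apply: eq_bigr => k _; rewrite /= mulrCA -mulrDr; congr (_ * _).
rewrite /slot big_distrr -big_split; apply: eq_bigr => b _ /=.
by rewrite /fun_of_rV !mxE mulrDr mulrCA.
Qed.

Fact tensor_bracket x y P Q u :
  tensor_act (bracket x y) (P * Q) u =
  tensor_act x P (tensor_act y Q u) - tensor_act y Q (tensor_act x P u).
Proof.
apply/rowP => i; rewrite !mxE tact_bracket.
by congr (_ - _); apply: eq_tact => kap; rewrite fun_of_tensor_act.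
Qed.

(** The n-fold tensor power of C^(r+1), with factors evaluated at distinct
    points. *)
Definition tensor_module : current_module R r :=
  CurrentModule tensor_linear_sl tensor_linear_poly tensor_linear tensor_bracket.

(** The basis vectors of the tensor power. *)
Definition tbasis kap : tensor_module := delta_mx 0 (enum_rank kap).

Lemma fun_of_tbasis kap mu : fun_of_rV (tbasis kap) mu = (mu == kap)%:R.
Proof. by rewrite /fun_of_rV mxE eqxx (inj_eq enum_rank_inj). Qed.

(** The index of the n-th tensor power of the highest weight vector. *)
Definition kap0 : J := [ffun=> ord0].

(** The eigenvalue of the projection of E_aa (x) t^d to sl on this vector. *)
Definition tlam (a : I) (d : nat) : C :=
  (\sum_k pt k ^+ d) * ((a == ord0)%:R - r.+1%:R^-1).

Lemma tact_tbasis x P kap mu :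
  tact x P (fun_of_rV (tbasis kap)) mu =
    \sum_k P.[pt k] * (x (mu k) (kap k) * (upd mu k (kap k) == kap)%:R).
Proof.
apply: eq_bigr => k _; congr (_ * _); rewrite /slot (bigD1 (kap k)) //=.
rewrite fun_of_tbasis big1 ?addr0 // => b bk; rewrite fun_of_tbasis.
case: eqP => [e|_]; last by rewrite mulr0.
by move: bk; rewrite -{1}e upd_same eqxx.
Qed.

Lemma fun_of_rV_inj u w : fun_of_rV u =1 fun_of_rV w -> u = w.
Proof. by move=> e; apply/rowP => i; have := e (enum_val i); rewrite /fun_of_rV enum_valK. Qed.

Lemma tensor_hw : hw_vector (tbasis kap0) tlam.
Proof.
split=> [a b d ab b0|a d]; apply: fun_of_rV_inj => mu.
  rewrite fun_of_tensor_act tact_tbasis /fun_of_rV mxE big1 // => k _.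
  rewrite ffunE !mxE (negPf ab) mul0r mul0rn subr0.
  by rewrite [ord0 == b]eq_sym (negPf b0) andbF mul0r mulr0.
rewrite fun_of_tensor_act tact_tbasis.
rewrite (_ : fun_of_rV (_ *: _) mu = tlam a d * fun_of_rV (tbasis kap0) mu); last first.
  by rewrite /fun_of_rV mxE.
rewrite fun_of_tbasis /tlam -mulrA mulr_suml; apply: eq_bigr => k _.
rewrite hornerXn; congr (_ * _); rewrite ffunE.
have [->|ne] := eqVneq mu kap0.
  rewrite -{2}[ord0](ffunE (fun=> ord0) k) upd_id eqxx !mulr1 !mxE ffunE !eqxx.
  by rewrite mulr1n mul1r andbb eq_sym.
rewrite mulr0; case: eqP => [e|_]; last by rewrite mulr0.
rewrite !mxE; case: (eqVneq (mu k) ord0) => [mk|mk].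
  by case/eqP: ne; rewrite -e -mk upd_id.
rewrite mulr0n subr0 (_ : _ && _ = false) ?mul0r //.
by apply/negP => /andP[/eqP ma /eqP a0]; rewrite ma -a0 eqxx in mk.
Qed.

Lemma lagrange_exists (k : 'I_n) : exists P : {poly C}, forall l, P.[pt l] = (l == k)%:R.
Proof.
have ne l : l != k -> pt k - pt l != 0.
  by move=> lk; rewrite subr_eq0 eqr_nat eq_sym.
exists (\prod_(l | l != k) ((pt k - pt l)^-1 *: ('X - (pt l)%:P))) => l.
rewrite horner_prod; have [->|lk] := eqVneq l k.
  by apply: big1 => i ik; rewrite !hornerE mulVf // ne.
by rewrite (bigD1 l) //= !hornerE subrr mulr0 mul0r.
Qed.

(** Interpolation at distinct points makes sl act on each factor separately. *)
Lemma tensor_generated : generated_by (tbasis kap0).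
Proof.
move=> U [U0 UD Uact] Uv.
have sU : is_subspace U by split.
have Ub kap : U (tbasis kap).
  move eq : #|[pred k | kap k != ord0]| => q.
  elim: q kap eq => [|q IH] kap eq.
    rewrite (_ : kap = kap0) //; apply/ffunP => k; rewrite ffunE.
    by have := card0_eq eq k; rewrite inE => /negbFE/eqP.
  have [k kk] : exists k, kap k != ord0.
    by have /card_gt0P[k] : (0 < #|[pred k | kap k != ord0]|)%N by [rewrite eq]; exists k.
  have [P hP] := lagrange_exists k.
  pose kap' := upd kap k ord0.
  have : U (tbasis kap').
    apply: IH; move: eq; rewrite (cardD1 k) inE kk => -[<-].
    apply: eq_card => l; rewrite !inE ffunE.
    by case: (eqVneq l k) => //; rewrite eqxx.
  move=> /(Uact (unit_sl R (kap k) ord0) P); congr U.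
  apply: fun_of_rV_inj => mu; rewrite fun_of_tensor_act tact_tbasis fun_of_tbasis.
  rewrite (bigD1 k) //= big1 ?addr0 => [|l lk]; last by rewrite hP (negPf lk) mul0r.
  rewrite hP eqxx mul1r upd_same !mxE (negPf kk) mul0r mul0rn subr0 eqxx andbT.
  have [->|ne] := eqVneq mu kap; first by rewrite eqxx mul1r eqxx.
  have [e|_] := eqVneq (mu k) (kap k); last by rewrite mul0r.
  rewrite mul1r; case: eqP => // e'; case/eqP: ne.
  by rewrite -(upd_id mu k) e -(upd_upd mu k ord0) e' /kap' upd_upd upd_id.
move=> u; have -> : u = \sum_j u 0 j *: tbasis (enum_val j).
  rewrite {1}[u]row_sum_delta; apply: eq_bigr => j _.
  by rewrite /tbasis enum_valK.
apply: (subspace_sum sU) => j _; exact: (subspaceZ sU).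
Qed.

End Tensor.

(** * Lower bound: adapted bases *)

Section AdaptedBasis.
Variables (F : fieldType) (N : nat) (T : Type) (dg : T -> nat) (w : T -> 'rV[F]_N).

Definition family_mx k (f : 'I_k -> T) : 'M[F]_(k, N) := \matrix_i w (f i).

Hypothesis span_w : forall u, lspan (fun u => exists t, u = w t) u.

(** A family of maximal size among the free families of members of w. *)
Lemma basis_exists : exists f : 'I_N -> T, row_free (family_mx f).
Proof.
pose P k := `[< exists f : 'I_k -> T, row_free (family_mx f) >].
have P0 : exists k, P k.
  exists 0%N; apply/asboolP.
  exists (fun i : 'I_0 => match i with Ordinal m lm => match (notF lm) return T with end end).
  by rewrite /row_free -leqn0 rank_leq_row.
have Pub k : P k -> (k <= N)%N.
  by move=> /asboolP[f /eqP <-]; apply: rank_leq_col.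
have [k /asboolP[f ff] kmax] := ex_maxnP P0 Pub.
suff eN : k = N by move: f ff; rewrite eN => f ff; exists f.
apply/eqP; rewrite eqn_leq Pub; last by apply/asboolP; exists f.
have [all_in|] := pselect (forall t, (w t <= family_mx f)%MS).
  have full (u : 'rV_N) : (u <= family_mx f)%MS.
    pose U (x : 'rV[F]_N) : Prop := (x <= family_mx f)%MS.
    have sU : is_subspace U.
      split; first exact: sub0mx.
      by move=> a x y hx hy; apply: addmx_sub => //; apply: scalemx_sub.
    have hG g : (exists t, g = w t) -> U g by move=> [t ->]; apply: all_in.
    exact: (@span_w u U sU hG).
  have: (1%:M <= family_mx f)%MS by apply/row_subP => i; apply: full.
  by rewrite sub1mx => /eqP <-; apply: rank_leq_row.
move/existsNP => [t nt]; exfalso.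
have : P k.+1.
  apply/asboolP; pose g (i : 'I_k.+1) := oapp f t (unlift ord0 i).
  exists g; apply: inj_row_free => x hx.
  have e : x *m family_mx g = x 0 ord0 *: w t + (\row_j x 0 (lift ord0 j)) *m family_mx f.
    rewrite !mulmx_sum_row big_ord_recl rowK /g unlift_none /=; congr (_ + _).
    by apply: eq_bigr => j _; rewrite !rowK liftK mxE.
  have x0 : x 0 ord0 = 0.
    apply/eqP; apply: contraT => x0; case: nt.
    have -> : w t = (- (x 0 ord0)^-1 *: \row_j x 0 (lift ord0 j)) *m family_mx f.
      rewrite -scalemxAl; move: hx; rewrite e => /eqP; rewrite addr_eq0 => /eqP h.
      by rewrite scaleNr -scalerN -h scalerA mulVf // scale1r.
    exact: submxMl.
  move: hx; rewrite e x0 scale0r add0r => /(congr1 (mulmx^~ (pinvmx (family_mx f)))).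
  rewrite mul0mx mulmxKp // => hx; apply/rowP => i; rewrite mxE.
  by have [j ->|->] := unliftP ord0 i; [have /rowP /(_ j) := hx; rewrite !mxE|].
by move/kmax; rewrite ltnn.
Qed.

(** A basis of minimal total degree among the bases contained in a graded
    spanning family: by exchange, the members of degree d are combinations of the
    elements of degree at most d of the basis. *)
Lemma adapted_basis : exists f : 'I_N -> T, family_mx f \in unitmx /\
  forall t i, (dg (f i) > dg t)%N -> (w t *m invmx (family_mx f)) 0 i = 0.
Proof.
pose P s := `[< exists2 f : 'I_N -> T, row_free (family_mx f) & (\sum_i dg (f i) = s)%N >].
have P0 : exists s, P s.
  by have [f ff] := basis_exists; exists (\sum_i dg (f i))%N; apply/asboolP; exists f.
have [s /asboolP[f ff fs] smin] := ex_minnP P0.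
have uf : family_mx f \in unitmx by rewrite -row_free_unit.
exists f; split=> // t i lti; apply/eqP; apply: contraT => ci.
set c := _ *m _ in ci.
(* If the coordinate i of w t were not 0, exchanging would lower the degree. *)
pose g j := if j == i then t else f j.
have : P (\sum_j dg (g j))%N.
  apply/asboolP; exists g => //; apply: inj_row_free => x hx.
  have e : x *m family_mx g = (x 0 i *: c + \row_j (if j == i then 0 else x 0 j)) *m family_mx f.
    rewrite mulmxDl -scalemxAl mulmxKV // !mulmx_sum_row (bigD1 i) //= rowK /g eqxx.
    congr (_ + _); rewrite [RHS](bigD1 i) //= mxE eqxx scale0r add0r.
    by apply: eq_bigr => j /negPf ji; rewrite !rowK !mxE ji.
  move: hx; rewrite e => /(congr1 (mulmx^~ (invmx (family_mx f)))).
  rewrite mul0mx mulmxK // => /rowP hx.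
  have xi : x 0 i = 0.
    have := hx i; rewrite mxE [(_ *: c) _ _]mxE [(\row__ _) _ _]mxE [in RHS]mxE.
    by rewrite eqxx addr0 => /eqP; rewrite mulf_eq0 (negPf ci) orbF => /eqP.
  apply/rowP => j; rewrite [RHS]mxE; have := hx j; rewrite !mxE xi mul0r add0r.
  by case: eqP => [->|].
move/smin; rewrite leqNgt -fs (bigD1 i) //= [X in (_ < X)%N](bigD1 i) //= /g eqxx.
rewrite (eq_bigr (fun j => dg (f j))) ?ltn_add2r ?lti //.
by move=> j /negPf ->.
Qed.

End AdaptedBasis.

(** * Lower bound: the associated graded module *)

Lemma abel_summation (F : comNzRingType) (V : lmodType F) (h : nat -> F) (u : nat -> V) m :
  \sum_(k < m) (\sum_(l < k.+1) h l) *: (u k - u k.+1) =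
    \sum_(l < m.+1) h l *: u l - (\sum_(l < m.+1) h l) *: u m.
Proof.
elim: m => [|m IH]; first by rewrite big_ord0 !big_ord1 subrr.
rewrite big_ord_recr {}IH /= [\sum_(l < m.+2) h l *: u l]big_ord_recr /=.
rewrite [\sum_(l < m.+2) h l]big_ord_recr /= scalerBr addrA subrK.
by rewrite scalerDl opprD addrACA subrr addr0.
Qed.

(** The coroots and the fundamental weights are dual bases. *)
Lemma cartan_coroots (R : realType) (r : nat) (h : sl R r) : cartan h ->
  h = \sum_(k < r) fund_weight k h *: coroot R k.
Proof.
move=> ch; pose hh (l : nat) := h (inord l) (inord l).
pose u (l : nat) := unit_sl R (inord l : 'I_r.+1) (inord l).
have tr0 : \sum_(l < r.+1) hh l = 0.
  transitivity (\tr (sl_mx h)); last by apply/eqP; exact: (valP h).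
  by apply: eq_bigr => l _; rewrite /hh inord_val.
transitivity (\sum_(l < r.+1) hh l *: u l).
  rewrite {1}[h]sl_decomp; apply: eq_bigr => a _; rewrite (bigD1 a) //= big1 ?addr0.
    by rewrite /hh /u inord_val.
  by move=> b ba; move/is_diag_mxP: ch => -> //; rewrite ?scale0r // eq_sym.
have := abel_summation hh u r; rewrite tr0 scale0r subr0 => <-.
apply: eq_bigr => k _; rewrite coroot_unit_sl /u; congr (_ *: (_ - _)).
- rewrite /fund_weight /hh.
  rewrite (big_ord_widen r.+1 (fun l => h (inord l) (inord l))) ?ltnS ?(ltnW (ltn_ord k)) //.
  by apply: eq_big => [l|l _]; rewrite ?ltnS // inord_val.
- by congr unit_sl; apply/val_inj; rewrite /= inordK // ltnW // ltnS.
- by congr unit_sl; apply/val_inj; rewrite /= inordK // ltnS.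
Qed.

Section CorootAction.
Variables (R : realType) (r : nat) (V : current_module R r).

(** The shift s accounts for the projection of the E_aa to sl. *)
Lemma coroot_eigen (c : 'I_r.+1 -> int) (s : R[i]) (w : V) (k : 'I_r) :
  (forall a, eop a a 0 w = ((c a)%:~R - s) *: w) ->
  cm_act (coroot R k) 1 w =
    (c (widen_ord (leqnSn r) k) - c (lift ord0 k))%:~R *: w.
Proof.
move=> h; rewrite coroot_unit_sl (linB (@cm_linear_sl _ _ V 1 w)).
rewrite -!eop0_cm !h -scalerBl rmorphB /=; congr (_ *: _).
by rewrite opprB addrA subrK.
Qed.

Lemma cartan_eigen (mu : {ffun 'I_r -> int}) (h : sl R r) (w : V) :
  (forall k, cm_act (coroot R k) 1 w = (mu k)%:~R *: w) -> cartan h ->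
  cm_act h 1 w = weight_eval mu h *: w.
Proof.
move=> hw /cartan_coroots {1}->; rewrite (lin_sum (@cm_linear_sl _ _ V 1 w)).
rewrite /weight_eval scaler_suml; apply: eq_bigr => k _.
by rewrite (linZ (@cm_linear_sl _ _ V 1 w)) hw scalerA mulrC.
Qed.

End CorootAction.

(** The section takes any module on row vectors with a vector v as in hw_vector and
    an adapted basis of words, the rows of M; dg is the degree of the words of the
    basis, and co u the row of coordinates of u. *)
Section Graded.
Variables (R : realType) (r n N : nat).
Local Notation C := R[i].
Local Notation I := 'I_r.+1.
Variable act : sl R r -> {poly C} -> 'rV[C]_N -> 'rV[C]_N.
Hypotheses
  (act1 : forall P v, linear (fun x => act x P v))
  (act2 : forall x v, linear (fun P => act x P v))
  (act3 : forall x P, linear (act x P))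
  (actB : forall x y P Q v, act (bracket x y) (P * Q) v =
     act x P (act y Q v) - act y Q (act x P v)).
Let X : current_module R r := CurrentModule act1 act2 act3 actB.
Variables (v : X) (lam : I -> nat -> C).
Hypotheses (hw : hw_vector v lam)
  (lam0 : forall a, lam a 0 = n%:R * ((a == ord0)%:R - r.+1%:R^-1)).
Variable f : 'I_N -> seq ('I_r * nat).
Let M : 'M[C]_N := family_mx (fun L => word v L : 'rV[C]_N) f.
Let dg i := deg (f i).
Let co (u : 'rV[C]_N) : 'rV[C]_N := u *m invmx M.
Hypotheses (uM : M \in unitmx)
  (supp : forall L i, (dg i > deg L)%N -> co (word v L) 0 i = 0).

Let co_linear : linear co.
Proof. by move=> a u w; rewrite /co mulmxDl scalemxAl. Qed.

Let co_supp d u i : wspan v d u -> (d < dg i)%N -> co u 0 i = 0.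
Proof.
move=> hu lti; apply: (lspan_map (f := co) (U := fun u : 'rV_N => u 0 i = 0) co_linear _ _ hu).
  by split=> [|a x y hx hy]; rewrite !mxE // hx hy mulr0 addr0.
by move=> _ [L hL ->]; apply: supp; apply: leq_ltn_trans lti.
Qed.

Let wordX (i : 'I_N) : 'rV[C]_N := word v (f i).

Let co_wordX i : co (wordX i) = delta_mx 0 i.
Proof. by rewrite /co -[wordX i](rowK (fun i => wordX i)) -row_mul mulmxV // row1. Qed.

Let co_exp u : u = \sum_i co u 0 i *: wordX i.
Proof.
rewrite -{1}[u](mulmxKV uM) -/(co u) mulmx_sum_row; apply: eq_bigr => i _.
by rewrite rowK.
Qed.

(* The matrix of x (x) t^d in the adapted basis.  It vanishes at the entries which
   raise the degree by more than d. *)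
Let Ax x d : 'M[C]_N := \matrix_i co (act x 'X^d (wordX i)).

Let co_act x d u : co (act x 'X^d u) = co u *m Ax x d.
Proof.
rewrite {1}[u]co_exp (lin_sum (act3 x 'X^d)) (lin_sum co_linear) mulmx_sum_row.
by apply: eq_bigr => i _; rewrite (linZ (act3 x 'X^d)) (linZ co_linear) rowK.
Qed.

Let Ax_supp x d i j : (dg i + d < dg j)%N -> Ax x d i j = 0.
Proof.
move=> lt; rewrite mxE; apply: (co_supp _ lt).
have sub := wspan_sub v (dg i + d).
rewrite -[act _ _ _]/(@cm_act _ _ X x 'X^d (wordX i)) cm_actE.
do 3!apply: (subspace_sum sub) => ? _; rewrite coefXn.
case: eqP => [->|_]; last by rewrite mulr0 scale0r; apply: (subspace0 sub).
apply: (subspaceZ sub); apply: (wspan_eop hw); apply: lspan_gen.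
by exists (f i).
Qed.

Let Ax_bracket x y d e :
  Ax (bracket x y) (d + e) = Ax y e *m Ax x d - Ax x d *m Ax y e.
Proof.
apply/row_matrixP => i; rewrite raddfB /= !row_mul !rowK exprD actB.
by rewrite (linB co_linear) !co_act.
Qed.

(* The associated graded action in the coordinates of the adapted basis: only
   the entries of Ax x d raising the degree by exactly d are kept. *)
Let G x (P : {poly C}) : 'M[C]_N := \matrix_(i, j)
  if (dg i <= dg j)%N then P`_(dg j - dg i) * Ax x (dg j - dg i) i j else 0.

(* A product of entries raising the degree by at most d and e, which raises it by
   d + e, has factors raising it by exactly d and e. *)
Let G_mul x y P Q i j : (G y Q *m G x P) i j =
  if (dg i <= dg j)%N then
    \sum_(a < (dg j - dg i).+1) P`_a * Q`_(dg j - dg i - a) *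
      (Ax y (dg j - dg i - a) *m Ax x a) i j
  else 0.
Proof.
rewrite mxE; case: leqP => [leij|ltji]; last first.
  apply: big1 => l _; rewrite !mxE; case: leqP => [leil|]; last by rewrite mul0r.
  by rewrite leqNgt (leq_trans ltji leil) mulr0.
under [RHS]eq_bigr do rewrite mxE big_distrr /=.
rewrite exchange_big; apply: eq_bigr => l _ /=; rewrite [G y Q i l]mxE [G x P l j]mxE.
case: (leqP (dg i) (dg l)) => [leil|ltli]; last first.
  rewrite mul0r big1 // => a _.
  by rewrite [Ax x a l j]Ax_supp ?mulr0 //; have := ltn_ord a; lia.
case: (leqP (dg l) (dg j)) => [lelj|ltjl]; last first.
  rewrite mulr0 big1 // => a _.
  by rewrite [Ax y _ i l]Ax_supp ?mul0r ?mulr0 //; have := ltn_ord a; lia.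
have ha : (dg j - dg l < (dg j - dg i).+1)%N by lia.
rewrite (bigD1 (Ordinal ha)) //= big1 ?addr0 => [|a].
  have -> : (dg j - dg i - (dg j - dg l) = dg l - dg i)%N by lia.
  ring.
rewrite -val_eqE /= => /eqP na; have := ltn_ord a => lta.
have [lt|] := ltnP (dg i + (dg j - dg i - a)) (dg l).
  by rewrite [Ax y _ i l]Ax_supp ?mul0r ?mulr0.
move=> ge; rewrite [Ax x a l j]Ax_supp ?mulr0 //; lia.
Qed.

Let G_bracket x y P Q : G (bracket x y) (P * Q) = G y Q *m G x P - G x P *m G y Q.
Proof.
apply/matrixP => i j; rewrite [RHS]mxE [X in _ = _ + X]mxE !G_mul mxE.
case: leqP => [leij|_]; last by rewrite subrr.
set e := (dg j - dg i)%N; rewrite coefM mulr_suml.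
rewrite [X in _ = _ - X](reindex_inj rev_ord_inj) -sumrB; apply: eq_bigr => a _ /=.
have lea : (a <= e)%N by rewrite -ltnS.
rewrite !subSS !(subKn lea) [Q`__ * _]mulrC -mulrBr; congr (_ * _).
by rewrite -{1}(subnKC lea) Ax_bracket !mxE.
Qed.

(* The right action of the matrices G on row vectors. *)
Let gact x P (u : 'rV[C]_N) : 'rV[C]_N := u *m G x P.

Let Ax_linear d : linear (fun x => Ax x d).
Proof.
move=> a x y; apply/row_matrixP => i.
by rewrite linearP /= !rowK act1 co_linear.
Qed.

Let gact1 P u : linear (fun x => gact x P u).
Proof.
move=> a x y; rewrite /gact scalemxAr -mulmxDr; congr (_ *m _).
apply/matrixP => i j; rewrite [RHS]mxE [X in _ = X + _]mxE [G (_ + _) P i j]mxE.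
rewrite [G x P i j]mxE [G y P i j]mxE; case: leqP => _; last by rewrite mulr0 addr0.
by rewrite Ax_linear [X in _ * X = _]mxE [X in _ * (X + _) = _]mxE mulrDr mulrCA.
Qed.

Let gact2 x u : linear (fun P => gact x P u).
Proof.
move=> a P Q; rewrite /gact scalemxAr -mulmxDr; congr (_ *m _).
apply/matrixP => i j; rewrite [RHS]mxE [X in _ = X + _]mxE [G x (_ + _) i j]mxE.
rewrite [G x P i j]mxE [G x Q i j]mxE; case: leqP => _; last by rewrite mulr0 addr0.
by rewrite coefD coefZ mulrDl mulrA.
Qed.

Let gact3 x P : linear (gact x P).
Proof. by move=> a u w; rewrite /gact mulmxDl scalemxAl. Qed.

Let gactB x y P Q u : gact (bracket x y) (P * Q) u =
  gact x P (gact y Q u) - gact y Q (gact x P u).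
Proof. by rewrite /gact G_bracket mulmxBr !mulmxA. Qed.

(** The associated graded module. *)
Definition graded_module : current_module R r :=
  CurrentModule gact1 gact2 gact3 gactB.

(** The image of v in the associated graded module. *)
Definition graded_vector : graded_module := co v.

Let co_v i : (0 < dg i)%N -> co v 0 i = 0.
Proof. by move=> h; apply: (@supp [::]). Qed.

Let gact_v x P j : gact x P (co v) 0 j = P`_(dg j) * co (act x 'X^(dg j) v) 0 j.
Proof.
rewrite co_act /gact !mxE big_distrr; apply: eq_bigr => i _ /=.
have [i0|/co_v ->] := posnP (dg i); last by rewrite !mul0r mulr0.
by rewrite [G x P i j]mxE i0 subn0 mulrCA.
Qed.

Let co0 : co 0 = 0. Proof. exact: (lin0 co_linear). Qed.

Lemma graded_weyl_generator : weyl_generator n graded_vector.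
Proof.
have croot (k : 'I_r) d : act (coroot R k) 'X^d v =
    (lam (widen_ord (leqnSn r) k) d - lam (lift ord0 k) d) *: v.
  rewrite coroot_unit_sl (linB (act1 'X^d v)).
  rewrite -[act _ _ _]/(eop (V := X) _ _ _ _).
  rewrite -[act (unit_sl R (lift _ _) _) _ _]/(eop (V := X) _ _ _ _).
  by rewrite !(proj2 hw) scalerBl.
have croot_v (k : 'I_r) P : cm_act (coroot R k) P graded_vector =
    (P.[0] * (n%:R * (k == 0%N :> nat)%:R)) *: graded_vector.
  apply/rowP => j; rewrite -[cm_act _ _ _]/(gact _ _ _) gact_v croot (linZ co_linear).
  rewrite mxE [RHS]mxE mulrA -[graded_vector 0 j]/(co v 0 j).
  have [j0|/co_v ->] := posnP (dg j); last by rewrite !mulr0.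
  rewrite j0 -horner_coef0 !lam0 -mulrBr opprB addrA subrK lift0_neq subr0.
  by rewrite !mulrA -val_eqE.
split=> [x P hx|k P k0|k P k0].
- apply/rowP => j; rewrite -[cm_act _ _ _]/(gact _ _ _) gact_v.
  rewrite [act _ _ _](_ : _ = 0) ?co0 ?mxE ?mulr0 //.
  rewrite -[act _ _ _]/(@cm_act _ _ X x 'X^(dg j) v) cm_actE.
  apply: big1 => a _; apply: big1 => b _; apply: big1 => d _.
  have [ab|ba] := ltnP a b; last by rewrite hx // mul0r scale0r.
  rewrite (proj1 hw) ?scaler0 //; first by rewrite -val_eqE neq_ltn ab.
  by rewrite -val_eqE /= -lt0n (leq_ltn_trans _ ab).
- by rewrite croot_v k0 eqxx mulr1 mulrC.
- by rewrite croot_v eqn0Ngt k0 mulr0 mulr0 scale0r.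
Qed.

(* In the graded module, a word is the component of degree deg L of the original
   word. *)
Let gword_co L j : (word (V := graded_module) graded_vector L : 'rV[C]_N) 0 j =
  if dg j == deg L then co (word v L) 0 j else 0.
Proof.
elim: L j => [|[k d] L IH] j.
  rewrite /word /=; case: posnP => // h; rewrite -[graded_vector 0 j]/(co v 0 j).
  by rewrite co_v.
pose gL : 'rV[C]_N := word (V := graded_module) graded_vector L; rewrite -/gL in IH.
rewrite -[LHS]/(gact (unit_sl R (lift ord0 k) ord0) 'X^d gL 0 j).
rewrite -[word v _]/(act (unit_sl R (lift ord0 k) ord0) 'X^d (word v L)).
rewrite co_act /gact !mxE; set x := unit_sl _ _ _.
have -> : deg ((k, d) :: L) = (deg L + d)%N by rewrite /deg /= addnC.
case: eqP => [ej|nej]; last first.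
  apply: big1 => i _; rewrite IH; case: eqP => [ei|_]; last by rewrite mul0r.
  rewrite [G x 'X^d i j]mxE coefXn; case: leqP => [le|_]; last by rewrite mulr0.
  case: eqP => [e|_]; last by rewrite mul0r mulr0.
  by case: nej; rewrite -ei; lia.
apply: eq_bigr => i _; rewrite IH; case: eqP => [ei|nei].
  by rewrite [G x 'X^d i j]mxE coefXn ei ej leq_addr addKn eqxx mul1r.
rewrite mul0r; have [lt|ge] := ltnP (deg L) (dg i); first by rewrite supp ?mul0r.
by rewrite Ax_supp ?mulr0 //; lia.
Qed.

Lemma graded_generated : generated_by graded_vector.
Proof.
move=> U [U0 UD Uact] Uv; have sU : is_subspace U by split.
have Uw L : U (word (V := graded_module) graded_vector L).
  by elim: L => //= p L; apply: Uact.
move=> w; rewrite [w](@row_sum_delta _ N); apply: (subspace_sum sU) => i _.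
apply: (subspaceZ sU).
have -> : delta_mx 0 i = word (V := graded_module) graded_vector (f i); last exact: Uw.
apply/rowP => j; rewrite gword_co -[word v (f i)]/(wordX i) co_wordX.
case: eqP => // ne; rewrite mxE eqxx /=; case: eqP => // e.
by case: ne; rewrite e.
Qed.

(** The words of the basis are weight vectors, so that the Cartan subalgebra acts
    by diagonal matrices. *)
Lemma graded_integrable : integrable_module graded_module.
Proof.
pose cnt (i : 'I_N) (a : I) : int :=
  (count (fun p => lift ord0 p.1 == a) (f i))%:Z
    + (a == ord0)%:Z * (n%:Z - (size (f i))%:Z).
pose nu (i : 'I_N) : {ffun 'I_r -> int} :=
  [ffun k => cnt i (widen_ord (leqnSn r) k) - cnt i (lift ord0 k)].
have wt i (h : sl R r) : cartan h -> act h 1 (wordX i) = weight_eval (nu i) h *: wordX i.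
  move=> ch; apply: (@cartan_eigen _ _ X) => // k.
  rewrite ffunE; apply: (@coroot_eigen _ _ X _ (n%:R / r.+1%:R)) => a.
  rewrite (eop_diag_word hw) lam0 /cnt; congr (_ *: _).
  rewrite rmorphD rmorphM rmorphB /= !pmulrn; ring.
have act_h (h : sl R r) (u : 'rV[C]_N) j : cartan h ->
    gact h 1 u 0 j = weight_eval (nu j) h * u 0 j.
  move=> ch; rewrite /gact mxE (bigD1 j) //= big1 ?addr0.
    rewrite mxE leqnn subnn coef1 mul1r mxE expr0 wt // (linZ co_linear) co_wordX.
    by rewrite !mxE !eqxx mulr1 mulrC.
  move=> i ij; rewrite mxE; case: leqP => [le|_]; last by rewrite mulr0.
  rewrite coef1; case: eqP => [e|_]; last by rewrite mul0r mulr0.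
  rewrite e mxE expr0 wt // (linZ co_linear) co_wordX !mxE.
  by rewrite eq_sym (negPf ij) andbF !mulr0.
pose s := undup [seq nu i | i <- enum 'I_N].
have us : uniq s := undup_uniq _.
pose D : 'I_(size s) -> {ffun 'I_r -> int} := tnth (in_tuple s).
exists (size s), D; split; first exact/tuple_uniqP.
have exD j : exists k, D k = nu j.
  have : nu j \in in_tuple s by rewrite mem_undup map_f // mem_enum.
  by move=> /tnthP[k ->]; exists k.
have sep k (u : 'rV[C]_N) j :
    weight_space (V := graded_module) (D k) u -> D k != nu j -> u 0 j = 0.
  move=> hu ne; have [l neq] : exists l, D k l != nu j l.
    apply/existsP; apply: contraNT ne; rewrite negb_exists => /forallP h.
    by apply/eqP/ffunP => l; apply/eqP; have := h l; rewrite negbK.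
  have chl : cartan (coroot R l).
    apply/is_diag_mxP => a b ab /=; rewrite !mxE.
    have no m : (a == m) && (b == m) = false.
      by apply/negP => /andP[/eqP ea /eqP eb]; move: ab; rewrite ea eb eqxx.
    by rewrite !no subrr.
  have ev (mu : {ffun 'I_r -> int}) : weight_eval mu (coroot R l) = (mu l)%:~R.
    rewrite /weight_eval (bigD1 l) //= fund_weight_coroot eqxx mulr1 big1 ?addr0 //.
    by move=> m ml; rewrite fund_weight_coroot (negPf ml) mulr0.
  have := congr1 (fun u : 'rV[C]_N => u 0 j) (hu _ chl).
  rewrite -[cm_act _ _ _]/(gact _ _ _) act_h // !ev [RHS]mxE => /eqP.
  rewrite -subr_eq0 -mulrBl mulf_eq0 subr_eq0 eqr_int eq_sym (negPf neq) /=.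
  by move/eqP.
move=> u; pose p : {ffun 'I_(size s) -> graded_module} :=
  [ffun k => \row_j (if D k == nu j then (u : 'rV[C]_N) 0 j else 0)].
have sum_at (q : {ffun 'I_(size s) -> graded_module}) j :
    (forall k, weight_space (D k) (q k)) ->
    forall k, D k = nu j -> (\sum_k q k : 'rV[C]_N) 0 j = (q k : 'rV[C]_N) 0 j.
  move=> hq k ek; rewrite summxE (bigD1 k) //= big1 ?addr0 // => l lk.
  apply: (sep l) => //; rewrite -ek; apply: contra lk => /eqP e.
  by apply/eqP; apply: (tuple_uniqP (in_tuple s) us).
have hp k : weight_space (D k) (p k).
  move=> h ch; apply/rowP => j; rewrite -[cm_act _ _ _]/(gact _ _ _) act_h //.
  by rewrite [RHS]mxE !ffunE !mxE; case: eqP => [->//|_]; rewrite !mulr0.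
have sp : u = \sum_k p k.
  apply/rowP => j; have [k ek] := exD j.
  by rewrite (sum_at p j hp k ek) ffunE mxE ek eqxx.
exists p; split=> // q [hq sq]; apply/ffunP => k; apply/rowP => j.
have [ek|ne] := eqVneq (D k) (nu j); last by rewrite (sep k (p k)) // (sep k (q k)).
by rewrite -(sum_at p j hp k ek) -(sum_at q j hq k ek) -sp -sq.
Qed.

End Graded.

(** * Multinomial coefficients and the dimensions *)

Lemma prod_fact_dvd q (i : 'I_q -> nat) :
  (\prod_a (i a)`! %| (\sum_a i a)`!)%N.
Proof.
elim: q i => [|q IH] i; first by rewrite !big_ord0.
rewrite !big_ord_recl -(bin_fact (leq_addr _ (i ord0))) addKn.
by apply: dvdn_mull; apply: dvdn_mul.
Qed.

Section Multinomial.

(* The truncated exponential series. *)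
Let texp n : {poly rat} := \poly_(k < n.+1) (k`!%:R)^-1.

Let coef_texp n q m : (m <= n)%N -> (texp n ^+ q)`_m = q%:R ^+ m / m`!%:R.
Proof.
elim: q m => [|q IH] m le_mn.
  rewrite expr0 coef1 expr0n; case: eqP => [->|_]; last by rewrite mul0r.
  by rewrite fact0 divr1.
rewrite exprS coefM.
have fn0 k : k`!%:R != 0 :> rat by rewrite pnatr_eq0 -lt0n fact_gt0.
apply: (mulIf (fn0 m)); rewrite divfK // mulr_suml -[q.+1%:R]natr1 exprDn.
apply: eq_bigr => k _ /=.
have lek : (k <= m)%N by rewrite -ltnS.
rewrite coef_poly ltnS (leq_trans lek le_mn) IH ?(leq_trans (leq_subr _ _)) //.
rewrite expr1n mulr1 -[_ *+ 'C(_, _)]mulr_natr.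
have <- : ('C(m, k) * (k`! * (m - k)`!) = m`!)%N by rewrite bin_fact.
by rewrite !natrM; field; rewrite !fn0.
Qed.

(** Both sides are n! times the coefficient of degree n of exp(X)^q. *)
Lemma sum_multinomial q n :
  (\sum_(i : {ffun 'I_q -> 'I_n.+1} | (\sum_a i a == n)%N) n`! %/ \prod_a (i a)`! = q ^ n)%N.
Proof.
have fn0 k : k`!%:R != 0 :> rat by rewrite pnatr_eq0 -lt0n fact_gt0.
apply/eqP; rewrite -(eqr_nat rat) natr_sum natrX; apply/eqP.
transitivity (n`!%:R * (texp n ^+ q)`_n); last by rewrite coef_texp // mulrC divfK.
rewrite -[q in RHS]card_ord -prodr_const /texp poly_def.
rewrite (eq_bigr (fun _ : 'I_q => \sum_(k < n.+1) (k`!%:R)^-1 *: 'X^k)) //.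
rewrite bigA_distr_bigA coef_sum big_distrr big_mkcond; apply: eq_bigr => i _ /=.
have -> : \prod_a ((i a)`!%:R^-1 *: 'X^(i a)) =
    (\prod_a ((i a)`!%:R^-1 : rat)) *: 'X^(\sum_a i a) :> {poly rat}.
  by rewrite scaler_prod -expr_sum.
rewrite coefZ coefXn eq_sym; case: eqP => [e|_]; last by rewrite !mulr0.
have dv : (\prod_a (i a)`! %| n`!)%N.
  by have := prod_fact_dvd (fun a => i a : nat); rewrite -e.
have ne : (\prod_a (i a)`!)%:R != 0 :> rat.
  by rewrite pnatr_eq0 -lt0n prodn_gt0 // => a; apply: fact_gt0.
by apply: (mulIf ne); rewrite -natrM divnK // mulr1 prodfV natr_prod divfK // -natr_prod.
Qed.

End Multinomial.

Lemma spanning_free (F : fieldType) m N (b : 'I_m -> 'rV[F]_N) : m = N ->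
  (forall w, lspan (fun w => exists k, w = b k) w) ->
  forall a : 'rV[F]_m, \sum_k a 0 k *: b k = 0 -> a = 0.
Proof.
move=> e; case: N / e b => b hb a ha.
pose B := \matrix_k b k.
have full (u : 'rV_m) : (u <= B)%MS.
  pose U (x : 'rV[F]_m) : Prop := (x <= B)%MS.
  have sU : is_subspace U.
    split; first exact: sub0mx.
    by move=> c x y hx hy; apply: addmx_sub => //; apply: scalemx_sub.
  have hG g : (exists k, g = b k) -> U g by move=> [k ->]; rewrite -(rowK b k); apply: row_sub.
  exact: (@hb u U sU hG).
have: row_full B by rewrite -sub1mx; apply/row_subP => k; apply: full.
rewrite row_full_unit -row_free_unit => fB.
apply: (row_free_inj fB); rewrite mul0mx mulmx_sum_row -[RHS]ha.
by apply: eq_bigr => k _; rewrite rowK.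
Qed.

(** The last clause says that the dimension of V is at least (r+1)^n. *)
Lemma weyl_candidate_exists (R : realType) (r n : nat) :
  exists (V : current_module R r) (v : V), weyl_candidate n v /\
    forall b : 'I_(r.+1 ^ n) -> V,
      (forall w, lspan (fun w => exists k, w = b k) w) ->
      forall a : 'rV[R[i]]_(r.+1 ^ n), \sum_k a 0 k *: b k = 0 -> a = 0.
Proof.
pose N := #|{: {ffun 'I_n -> 'I_r.+1}}|.
have eN : (r.+1 ^ n)%N = N by rewrite /N card_ffun !card_ord.
pose v0 : tensor_module R r n := tbasis R (kap0 r n).
have span := generated_words (@tensor_hw R r n) (@tensor_generated R r n).
have [f [uM supp]] := @adapted_basis _ N _ (@deg r) (fun L => word v0 L) span.
have lam0 (a : 'I_r.+1) : tlam R n a 0 = n%:R * ((a == ord0)%:R - r.+1%:R^-1).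
  by rewrite /tlam; under eq_bigr do rewrite expr0; rewrite sumr_const card_ord.
have hw : hw_vector (V := CurrentModule (@tensor_linear_sl R r n) (@tensor_linear_poly R r n)
    (@tensor_linear R r n) (@tensor_bracket R r n)) v0 (@tlam R r n) by exact: tensor_hw.
exists (graded_module hw uM supp), (graded_vector hw uM supp); split; last first.
  by move=> b hb; apply: (@spanning_free _ _ N b eN hb).
split.
- exact: (graded_integrable hw lam0 uM supp).
- exact: graded_generated.
- exact: (graded_weyl_generator hw lam0 uM supp).
Qed.

(** The weight determines the type, as the sum of the entries is fixed. *)
Lemma type_of_weight r (i i' : 'I_r.+1 -> nat) :
  (\sum_a i a = \sum_a i' a)%N ->
  (forall k : 'I_r, (i (widen_ord (leqnSn r) k))%:Z - (i (lift ord0 k))%:Z =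
     (i' (widen_ord (leqnSn r) k))%:Z - (i' (lift ord0 k))%:Z) ->
  i =1 i'.
Proof.
move=> es ed; pose d a : int := (i a)%:Z - (i' a)%:Z.
have dS m (hm : (m < r.+1)%N) : d (Ordinal hm) = d ord0.
  elim: m hm => [|m IH] hm; first by congr d; apply: val_inj.
  have hm' : (m < r)%N by [].
  rewrite -(IH (leqW hm')) /d.
  have := ed (Ordinal hm').
  have -> : widen_ord (leqnSn r) (Ordinal hm') = Ordinal (leqW hm') by apply: val_inj.
  have -> : lift ord0 (Ordinal hm') = Ordinal hm by apply: val_inj.
  lia.
have d0 a : d a = d ord0 by case: a.
have : \sum_a d a = 0.
  by rewrite sumrB -!(big_morph Posz PoszD (erefl (Posz 0))) es subrr.
under eq_bigr do rewrite d0.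
rewrite sumr_const card_ord => /eqP; rewrite mulrn_eq0 /= => /eqP e0 a.
by have := d0 a; rewrite e0 => /eqP; rewrite subr_eq0 eqz_nat => /eqP.
Qed.

Lemma lspan_expand (F : nzRingType) (V : lmodType F) (T : finType) (b : T -> V) w :
  lspan (fun w => exists t, w = b t) w -> exists a : T -> F, w = \sum_t a t *: b t.
Proof.
move=> h; apply: (h (fun w => exists a : T -> F, w = \sum_t a t *: b t)).
  split.
- by exists (fun=> 0); rewrite big1 // => t _; rewrite scale0r.
- move=> c _ _ [a ->] [a' ->]; exists (fun t => c * a t + a' t).
  by rewrite scaler_sumr -big_split; apply: eq_bigr => t _; rewrite scalerDl scalerA.
move=> _ [t ->]; exists (fun u => (u == t)%:R).
by rewrite (bigD1 t) //= eqxx scale1r big1 ?addr0 // => u /negPf ->; rewrite scale0r.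
Qed.

(** A basis of U indexed by a finite type. *)
Lemma has_dim_fin (R : realType) (V : lmodType R[i]) (U : V -> Prop) (T : finType)
    (b : T -> V) :
  (forall t, U (b t)) ->
  (forall u, U u -> exists a : T -> R[i], u = \sum_t a t *: b t) ->
  (forall a : T -> R[i], \sum_t a t *: b t = 0 -> forall t, a t = 0) ->
  has_dim U #|T|.
Proof.
move=> Ub span free; exists (fun k => b (enum_val k)); split=> // u Uu.
have sumE (a : 'rV_#|T|) : \sum_(k < #|T|) a 0 k *: b (enum_val k) =
    \sum_t a 0 (enum_rank t) *: b t.
  rewrite [RHS](reindex _ (onW_bij _ (@enum_val_bij T))) /=.
  by apply: eq_bigr => k _; rewrite enum_valK.
have [a ea] := span u Uu; exists (\row_k a (enum_val k)); split.
  by rewrite sumE ea; apply: eq_bigr => t _; rewrite mxE enum_rankK.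
move=> a' ea'; apply/rowP => k; rewrite mxE.
have := free (fun t => a t - a' 0 (enum_rank t)).
move=> /(_ _ (enum_val k)); rewrite enum_valK => h; apply/eqP; rewrite -subr_eq0.
apply/eqP/h; under eq_bigr do rewrite scalerBl.
by rewrite sumrB -sumE -ea -ea' subrr.
Qed.

Section Assembly.
Variables (R : realType) (r n : nat) (W : current_module R r).
Local Notation C := R[i].
Local Notation I := 'I_r.+1.
Variable v : W.
Hypothesis hW : local_weyl_module n v.

Let intW : integrable_module W. Proof. by case: hW => [[]]. Qed.
Let genW : generated_by v. Proof. by case: hW => [[]]. Qed.
Let wgen : weyl_generator n v. Proof. by case: hW => [[]]. Qed.

(* The types, and the multinomial spanning family attached to each of them. *)
Let Ty := {i : {ffun I -> 'I_n.+1} | (\sum_a i a == n)%N}.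
Let mult (i : I -> nat) : nat := (n`! %/ \prod_a (i a)`!)%N.

Let type_basis : {e : forall i : Ty, 'I_(mult (fun a => val i a)) -> W |
  forall i, (forall t a, eop a a 0 (e i t) = ((val i a : nat)%:R - n%:R / r.+1%:R) *: e i t) /\
  forall L : seq ('I_r * nat),
    (forall j, count (fun p => p.1 == j) L = val i (lift ord0 j)) ->
    lspan (fun w => exists t, w = e i t) (word v L)}.
Proof.
have F (i : Ty) := cid (type_span intW wgen (eqP (valP i))).
by exists (fun i => sval (F i)) => i; apply: (svalP (F i)).
Qed.

Let e := sval type_basis.
Let e_weight i := proj1 (svalP type_basis i).
Let e_span i := proj2 (svalP type_basis i).

(* The union of these families has (r+1)^n members. *)
Let Idx := {i : Ty & 'I_(mult (fun a => val i a))}.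
Let tg (i : Ty) (l : 'I_(mult (fun a => val i a))) : Idx :=
  Tagged (fun i : Ty => 'I_(mult (fun a => val i a))) l.
Let E (t : Idx) : W := e (tagged t).

Let card_Idx : #|{: Idx}| = (r.+1 ^ n)%N.
Proof.
rewrite card_tagged sumnE big_map big_enum /=.
under eq_bigr do rewrite card_ord.
rewrite -sum_multinomial.
rewrite (reindex_omap (fun i : Ty => val i) insub) /=; last first.
  by move=> i hi; rewrite insubT.
by apply: eq_big => [i|//]; rewrite valK (valP i) eqxx.
Qed.

Lemma weyl_basis_span w : lspan (fun w => exists t, w = E t) w.
Proof.
have sub := lspan_subspace (fun w => exists t, w = E t).
have := generated_words (weyl_hw intW wgen) genW w; apply=> // _ [L ->].
have [ltn|len] := ltnP n (size L).
  by rewrite (word_eq0 intW wgen) //; apply: (subspace0 sub).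
(* The type of the word L. *)
pose c (a : I) := if unlift ord0 a is Some j
  then count (fun p : 'I_r * nat => p.1 == j) L else (n - size L)%N.
have c_le a : (c a < n.+1)%N.
  rewrite ltnS /c; case: unliftP => [j _|_]; last exact: leq_subr.
  exact: leq_trans (count_size _ _) len.
have sum_count : (\sum_(j < r) count (fun p : 'I_r * nat => p.1 == j) L = size L)%N.
  elim: (L) => [|p L' IH]; first by rewrite big1.
  by rewrite /= big_split IH (bigD1 p.1) //= eqxx big1 // => j; rewrite eq_sym => /negPf ->.
pose i : {ffun I -> 'I_n.+1} := [ffun a => Ordinal (c_le a)].
have sum_i : (\sum_a i a == n)%N.
  rewrite big_ord_recl ffunE /= {1}/c unlift_none.
  under eq_bigr do rewrite ffunE /= /c liftK.
  by rewrite sum_count subnK.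
have hL j : count (fun p => p.1 == j) L = val (Sub i sum_i : Ty) (lift ord0 j).
  by rewrite SubK ffunE /= /c liftK.
apply: lspan_mono (e_span hL) => w' [t ->].
by exists (tg t).
Qed.

(** The family spans, and has the size of the dimension of a quotient of W. *)
Lemma weyl_basis_free (al : Idx -> C) : \sum_t al t *: E t = 0 -> forall t, al t = 0.
Proof.
have [V [v' [cand free]]] := weyl_candidate_exists R r n.
have [f [fact fsurj fv]] := proj2 hW V v' cand.
have ec := esym card_Idx.
pose b (k : 'I_(r.+1 ^ n)) : W := E (enum_val (cast_ord ec k)).
have bE t : E t = b (cast_ord (esym ec) (enum_rank t)).
  by rewrite /b cast_ordKV enum_rankK.
have lf : linear f by move=> a x y; rewrite linearP.
have span_b w : lspan (fun w => exists k, w = f (b k)) w.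
  have [u <-] := fsurj w.
  apply: (lspan_map lf (lspan_subspace _) _ (weyl_basis_span u)) => _ [t ->].
  by apply: lspan_gen; rewrite bE; eexists.
move=> h0 t.
pose a : 'rV[C]_(r.+1 ^ n) := \row_k al (enum_val (cast_ord ec k)).
suff a0 : a = 0.
  have := congr1 (fun a : 'rV_ _ => a 0 (cast_ord (esym ec) (enum_rank t))) a0.
  by rewrite !mxE cast_ordKV enum_rankK.
apply: (free _ span_b); rewrite -[RHS](lin0 lf) -h0 (lin_sum lf).
rewrite [RHS](reindex (fun k => enum_val (cast_ord ec k))) /=; last first.
  exists (fun t => cast_ord (esym ec) (enum_rank t)) => x _; rewrite ?cast_ordKV ?enum_rankK //.
  by rewrite enum_valK cast_ordK.
by apply: eq_bigr => k _; rewrite mxE (linZ lf).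
Qed.

Let E_expand u : exists a : Idx -> C, u = \sum_t a t *: E t.
Proof. exact: lspan_expand (weyl_basis_span u). Qed.

Lemma weyl_dim : has_dim (fun _ : W => True) (r.+1 ^ n)%N.
Proof.
by rewrite -card_Idx; apply: has_dim_fin weyl_basis_free => // u _; apply: E_expand.
Qed.

Let coroot_basis (i : Ty) t k : cm_act (coroot R k) 1 (e (i := i) t) =
  ((val i (widen_ord (leqnSn r) k))%:Z - (val i (lift ord0 k))%:Z)%:~R *: e t.
Proof.
apply: (@coroot_eigen _ _ _ (fun a => (val i a : nat)%:Z) (n%:R / r.+1%:R)) => a.
by rewrite e_weight -pmulrn.
Qed.

Lemma weyl_weight_dim (i : I -> nat) : (\sum_a i a = n)%N ->
  has_dim (@coroot_weight_space R r W (fun k : 'I_r =>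
      (i (widen_ord (leqnSn r) k))%:Z - (i (lift ord0 k))%:Z)) (mult i).
Proof.
move=> sum_i.
have lt_i a : (i a < n.+1)%N by rewrite ltnS -sum_i (bigD1 a) //= leq_addr.
have sum_i' : (\sum_a [ffun a => Ordinal (lt_i a)] a == n)%N.
  by apply/eqP; rewrite -[RHS]sum_i; apply: eq_bigr => a _; rewrite ffunE.
pose i0 : Ty := Sub [ffun a => Ordinal (lt_i a)] sum_i'.
have i0E a : val i0 a = i a :> nat by rewrite SubK ffunE.
have -> : mult i = #|'I_(mult (fun a => val i0 a))|.
  by rewrite card_ord /mult; congr (_ %/ _)%N; apply: eq_bigr => a _; rewrite i0E.
apply: (has_dim_fin (b := @e i0)) => [t k|u hu|al h0 l].
- by rewrite coroot_basis !i0E.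
- have [a ea] := E_expand u.
  (* The members of the family of another type have another weight. *)
  have a0 t : tag t != i0 -> a t = 0.
    move=> ne; have [k nk] : exists k : 'I_r,
        (val (tag t) (widen_ord (leqnSn r) k))%:Z - (val (tag t) (lift ord0 k))%:Z
          != (i (widen_ord (leqnSn r) k))%:Z - (i (lift ord0 k))%:Z.
      apply/existsP; apply: contraNT ne; rewrite negb_exists => /forallP h.
      apply/eqP/val_inj/ffunP => b; apply: val_inj; rewrite /= i0E.
      apply: (type_of_weight (i := fun a => val (tag t) a)); last first.
        by move=> k; apply/eqP; have := h k; rewrite negbK.
      by rewrite sum_i; apply/eqP: (valP (tag t)).
    pose al (t : Idx) := a t * ((val (tag t) (widen_ord (leqnSn r) k))%:Z
      - (val (tag t) (lift ord0 k))%:Z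
      - ((i (widen_ord (leqnSn r) k))%:Z - (i (lift ord0 k))%:Z))%:~R.
    have : al t = 0.
      apply: weyl_basis_free; have := hu k; rewrite {1 2}ea.
      rewrite (lin_sum (@cm_linear _ _ W _ _)) scaler_sumr => /eqP.
      rewrite -subr_eq0 -sumrB => /eqP h; rewrite -[RHS]h; apply: eq_bigr => x _.
      rewrite (linZ (@cm_linear _ _ W _ _)) /E coroot_basis !scalerA -scalerBl.
      by rewrite [(_%:~R * a x)]mulrC -mulrBr -rmorphB.
    by move/eqP; rewrite mulf_eq0 intr_eq0 subr_eq0 (negPf nk) orbF => /eqP.
  exists (fun l => a (tg l)).
  transitivity (\sum_(j : Ty) \sum_l a (tg l) *: e (i := j) l).
    by rewrite ea sig_big_dep; apply: eq_bigr => -[j l].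
  rewrite (bigD1 i0) //= [X in _ + X]big1 ?addr0 // => j ji0.
  by apply: big1 => l _; rewrite a0 ?scale0r.
- pose al' (t : Idx) := \sum_k (t == tg k)%:R * al k.
  have : al' (tg l) = 0.
    apply: weyl_basis_free; rewrite -[RHS]h0; under eq_bigr do rewrite scaler_suml.
    rewrite exchange_big; apply: eq_bigr => k _.
    rewrite (bigD1 (tg k)) //= eqxx mul1r big1 ?addr0 // => t /negPf ->.
    by rewrite mul0r scale0r.
  rewrite /al' (bigD1 l) //= eqxx mul1r big1 ?addr0 // => k kl.
  by rewrite eq_Tagged /= eq_sym (negPf kl) mul0r.
Qed.

End Assembly.

Theorem proposition14 (R : realType) (r n : nat) (r_ge1 : (1 <= r)%N)
    (W : current_module R r) (v : W) (hW : local_weyl_module n v) :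
  has_dim (fun _ : W => True) (r.+1 ^ n)%N /\
  forall i : 'I_r.+1 -> nat, (\sum_(j < r.+1) i j = n)%N ->
    has_dim
      (@coroot_weight_space R r W (fun j : 'I_r =>
         (i (widen_ord (leqnSn r) j))%:Z - (i (lift ord0 j))%:Z))
      (n`! %/ \prod_(j < r.+1) (i j)`!)%N.
Proof.
split; first exact: (weyl_dim hW).
exact: (weyl_weight_dim hW).
Qed.
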